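(* Given a connected quasi-threshold graph $G$ with $n$ vertices and $m$ edges, the multiset of its Laplacian eigenvalues (all of which are integers) can be computed in $O(n+m)$ time.
   Context: All graphs are finite, simple and undirected, given by adjacency lists. The Laplacian matrix is $L(G)=D(G)-A(G)$ (diagonal degree matrix minus adjacency matrix). A graph is quasi-threshold if it contains neither $P_4$ nor $C_4$ as an induced subgraph. *)

(* Defs.v *)
From mathcomp Require Import all_boot all_order all_algebra.
From mathcomp Require Import algC.
Set Implicit Arguments. Unset Strict Implicit. Unset Printing Implicit Defensive.
Import GRing.Theory Num.Theory.

(* A graph on vertex set {0,...,n-1}, n = size adj; (nth [::] adj i) is the
   adjacency list of vertex i. *)
Definition nbrs (adj : seq (seq nat)) (i : nat) : seq nat := nth [::] adj i.
Definition adjb (adj : seq (seq nat)) (i j : nat) : bool := j \in nbrs adj i.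

Definition simple_graph (adj : seq (seq nat)) : Prop :=
  forall i, i < size adj ->
    [/\ all (fun j => j < size adj) (nbrs adj i), uniq (nbrs adj i),
        ~~ adjb adj i i & forall j, adjb adj i j -> adjb adj j i].

Definition num_vertices (adj : seq (seq nat)) : nat := size adj.
Definition num_edges (adj : seq (seq nat)) : nat := (sumn (map size adj)) %/ 2.

Definition connected (adj : seq (seq nat)) : Prop :=
  forall i j, i < size adj -> j < size adj ->
    exists p : seq nat, path (adjb adj) i p /\ last i p = j.

Definition induced_P4 (adj : seq (seq nat)) (a b c d : nat) : bool :=
  [&& adjb adj a b, adjb adj b c, adjb adj c d,
      ~~ adjb adj a c, ~~ adjb adj b d & ~~ adjb adj a d].
Definition induced_C4 (adj : seq (seq nat)) (a b c d : nat) : bool :=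
  [&& adjb adj a b, adjb adj b c, adjb adj c d, adjb adj d a,
      ~~ adjb adj a c & ~~ adjb adj b d].

Definition quasi_threshold (adj : seq (seq nat)) : Prop :=
  forall a b c d, a < size adj -> b < size adj -> c < size adj -> d < size adj ->
    uniq [:: a; b; c; d] ->
    ~~ induced_P4 adj a b c d /\ ~~ induced_C4 adj a b c d.

Definition laplacian (adj : seq (seq nat)) : 'M[int]_(size adj) :=
  \matrix_(i, j) (if i == j then (size (nbrs adj i))%:Z
                  else - (nat_of_bool (adjb adj i j))%:Z)%R.

(* Memory cells hold naturals, addresses are naturals; instructions with
   direct and indirect addressing, addition, truncated subtraction, zero test,
   jumps.  Each executed instruction costs one step. *)
Inductive instr : Type :=
| ICnst  of nat & nat          (* M[a] := k *)
| IAdd   of nat & nat & nat    (* M[a] := M[b] + M[c] *)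
| ISub   of nat & nat & nat    (* M[a] := M[b] - M[c] (truncated) *)
| ILoad  of nat & nat          (* M[a] := M[M[b]] *)
| IStore of nat & nat          (* M[M[a]] := M[b] *)
| IJz    of nat & nat          (* if M[a] = 0 then goto l *)
| IJmp   of nat                (* goto l *)
| IHalt.

Definition ram_mem := nat -> nat.
Definition upd (M : ram_mem) (a v : nat) : ram_mem := fun x => if x == a then v else M x.

Definition step (P : seq instr) (s : nat * ram_mem) : option (nat * ram_mem) :=
  let: (pc, M) := s in
  match nth IHalt P pc with
  | ICnst a k => Some (pc.+1, upd M a k)
  | IAdd a b c => Some (pc.+1, upd M a (M b + M c))
  | ISub a b c => Some (pc.+1, upd M a (M b - M c))
  | ILoad a b => Some (pc.+1, upd M a (M (M b)))
  | IStore a b => Some (pc.+1, upd M (M a) (M b))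
  | IJz a l => Some (if M a == 0 then l else pc.+1, M)
  | IJmp l => Some (l, M)
  | IHalt => None
  end.

(* run P t s = Some M  iff  P halts from s after fewer than t steps, with
   final memory M *)
Fixpoint run (P : seq instr) (t : nat) (s : nat * ram_mem) : option ram_mem :=
  match t with
  | 0 => None
  | t'.+1 => match step P s with
             | None => Some s.2
             | Some s' => run P t' s'
             end
  end.

Definition encode (adj : seq (seq nat)) : seq nat :=
  size adj :: flatten [seq size l :: l | l <- adj].
Definition init_mem (input : seq nat) : ram_mem := fun i => nth 0 input i.

Definition output (M : ram_mem) : seq nat := mkseq (fun i => M i.+1) (M 0).

(* Main.v *)
(** Call [u] above [v] when they are adjacent and [u] has the larger degree, ties being
    broken by the label. In a quasi-threshold graph adjacent vertices have nested closed
    neighbourhoods, so "above" is a forest order whose comparability graph is the graph.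
    Let [d v] be the number of vertices above [v]. Eliminating vertices from the bottom
    up factors [x - L] as [U D U^T] with [U] unitriangular for the forest order and
    [D v = (x - d v) (x - deg v - 1) / (x - d v - 1)]; hence, as multisets,
    [spectrum + {d v + 1} = {deg v + 1} + {d v}], and the multiplicity of an eigenvalue
    [j] is read off three histogram entries. The depths [d v] come from one pass over
    the edges, each edge incrementing the depth of its lower endpoint.

    On the machine the input fills the low cells, so there is no free register at the
    start. However the adjacency list of vertex 0 is redundant, every edge [u < v] being
    listed at [v]; this gives one scratch cell, which suffices to replace [n] and
    [d = deg 0 < n] reversibly by the number [d + n (n - 1) / 2], a multiple of which is
    an address beyond the input where the contents of the registers can be saved. *)
Require Import Defs.
From Stdlib Require Import FunctionalExtensionality.
From mathcomp Require Import all_boot all_order all_algebra.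
From mathcomp Require Import fingroup perm algC zify ring.
Set Implicit Arguments. Unset Strict Implicit. Unset Printing Implicit Defensive.
Import GRing.Theory Num.Theory.

(** * Spectrum of a quasi-threshold graph *)

Section Spectrum.
Local Open Scope ring_scope.
Variables (n : nat) (e : rel 'I_n).
Hypothesis e_sym : symmetric e.
Hypothesis e_irr : irreflexive e.
(** Covers both forbidden subgraphs at once: whether [a] and [d] are adjacent is left open. *)
Hypothesis e_qt : forall a b c d, uniq [:: a; b; c; d] ->
  e a b -> e b c -> e c d -> ~~ e a c -> ~~ e b d -> False.

Definition gdeg (v : 'I_n) : nat := #|[pred u | e v u]|.

Definition above (u v : 'I_n) : bool :=
  e u v && ((gdeg v < gdeg u) || (gdeg u == gdeg v) && (u < v))%N.

Definition depth (v : 'I_n) : nat := #|[pred u | above u v]|.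

(** If [x] were not adjacent to [u], the degree inequality would provide some [y] adjacent to [u]
    but not to [v], and [x, v, u, y] would induce a P4 or a C4. *)
Lemma nbr_subset u v x : e u v -> (gdeg v <= gdeg u)%N ->
  e v x -> x != u -> e u x.
Proof.
move=> euv le_vu evx xNu; apply/negPn/negP => Nux.
have cardE a b : e a b -> gdeg a = #|[pred w | e a w && (w != b)]|.+1.
  move=> eab; rewrite /gdeg (cardD1 b) !inE eab add1n; congr _.+1.
  by apply: eq_card => w; rewrite !inE andbC.
case: (boolP ([pred w | e u w && (w != v)] \subset [pred w | e v w && (w != u)])).
  move=> sub; suff /proper_card: [pred w | e u w && (w != v)] \proper
      [pred w | e v w && (w != u)].
    have evu : e v u by rewrite e_sym.
    by move: le_vu; rewrite (cardE _ _ euv) (cardE _ _ evu) ltnS leqNgt => /negP.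
  apply/properP; split=> //; exists x; rewrite !inE ?evx //.
  by rewrite (negPf Nux).
case/subsetPn=> y; rewrite !inE => /andP[euy yNv]; rewrite negb_and negbK.
have yNu : (y == u) = false by apply: contraTF euy => /eqP->; rewrite e_irr.
rewrite yNu orbF => Nvy.
apply: (e_qt (a := x) (b := v) (c := u) (d := y)) => //=; try by rewrite e_sym.
have xNv : x != v by apply: contraTneq evx => ->; rewrite e_irr.
have vNu : v != u by apply: contraTneq euv => ->; rewrite e_irr.
have xNy : x != y by apply: contraNneq Nvy => <-.
by rewrite !inE !negb_or xNv xNu xNy vNu (eq_sym v y) yNv eq_sym yNu.
Qed.

Lemma aboveP u v : reflect
  (e u v /\ ((gdeg v < gdeg u) \/ (gdeg u = gdeg v /\ (u < v)))%N) (above u v).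
Proof.
apply: (iffP andP) => -[euv]; first by move/orP=> [|/andP[/eqP]]; auto.
by move=> [->|[-> ->]]; rewrite ?eqxx ?orbT.
Qed.

Lemma above_irr v : above v v = false.
Proof. by rewrite /above e_irr. Qed.

Lemma above_trans : transitive above.
Proof.
move=> v u w /aboveP[euv ouv] /aboveP[evw ovw]; apply/aboveP; split; last by lia.
apply: (nbr_subset euv _ evw); first by lia.
by apply/eqP => wu; subst w; lia.
Qed.

Lemma above_asym u v : above u v -> above v u -> False.
Proof. by move=> uv /(above_trans uv); rewrite above_irr. Qed.

Lemma above_total u v : e u v = above u v || above v u.
Proof.
apply/idP/orP => [euv|[] /aboveP[]//]; last by rewrite e_sym.
have evu : e v u by rewrite e_sym.
have uNv : (u : nat) <> v by move=> /val_inj uv; rewrite uv e_irr in euv.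
suff: above u v \/ above v u by [].
by case: (ltngtP (gdeg u) (gdeg v)) => h; [right|left|
  case: (ltngtP u v) => // h'; [left|right]]; apply/aboveP; split=> //; auto.
Qed.

(** Nesting along the edge from [u] to [w] makes the neighbour [v] of [w] a neighbour of [u]. This
    is what turns the order into a forest. *)
Lemma above_chain u v w : above u w -> above v w ->
  [|| u == v, above u v | above v u].
Proof.
move=> /aboveP[euw ouw] /aboveP[evw ovw].
case: (eqVneq u v) => //= uNv; rewrite -above_total.
by apply: (nbr_subset euw); rewrite 1?e_sym 1?eq_sym //; lia.
Qed.

Lemma depth_lt u v : above u v -> (depth u < depth v)%N.
Proof.
move=> uv; apply/proper_card/properP; split.
  by apply/subsetP => w; rewrite !inE => /above_trans; apply.
by exists u; rewrite !inE ?above_irr.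
Qed.

Lemma gdegE v : gdeg v = (depth v + #|[pred w | above v w]|)%N.
Proof.
rewrite /gdeg /depth -cardUI (eq_card0 (A := [predI _ & _])) ?addn0; last first.
  by move=> w; rewrite !inE; apply/negbTE/negP => /andP[/above_asym].
by apply: eq_card => w; rewrite !inE above_total orbC.
Qed.

(** Depth strictly increases along the chain above [w], so the [depth w] depths occurring there are
    distinct and all below [depth w]. *)
Lemma depths_above w :
  perm_eq [seq depth v | v <- enum [pred u | above u w]] (iota 0 (depth w)).
Proof.
rewrite perm_sym; set s := map _ _.
have uniq_s : uniq s.
  rewrite map_inj_in_uniq ?enum_uniq // => u v; rewrite !mem_enum !inE => uw vw duv.
  case/or3P: (above_chain uw vw) => [/eqP //|/depth_lt|/depth_lt];
  by rewrite duv ltnn.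
have sub : {subset s <= iota 0 (depth w)}.
  by move=> k /mapP[v]; rewrite mem_enum inE mem_iota add0n => vw ->; exact: depth_lt.
have sz : (size (iota 0 (depth w)) <= size s)%N.
  by rewrite size_iota size_map -cardE.
have [_ mem_s] := uniq_min_size uniq_s sub sz.
by apply: uniq_perm => //; exact: iota_uniq.
Qed.

Lemma sum_above (R : zmodType) (g : nat -> R) w :
  \sum_(v | above v w) g (depth v) = \sum_(0 <= k < depth w) g k.
Proof.
rewrite /index_iota subn0 -(perm_big _ (depths_above w)) /= big_map big_enum.
by apply: eq_bigl => v; rewrite !inE.
Qed.

(** By the chain property a vertex above [w] is above [u], equals [u], or lies strictly between; the
    first two kinds carry exactly the depths 0 to [depth u]. *)
Lemma sum_between (R : zmodType) (g : nat -> R) u w : above u w ->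
  \sum_(v | above u v && above v w) g (depth v) =
  \sum_((depth u).+1 <= k < depth w) g k.
Proof.
move=> uw; have := sum_above g w.
rewrite (bigID (above u)) /= (bigD1 u (P := fun v => above v w && ~~ above u v)) /=;
  last by rewrite uw above_irr.
have -> : \sum_(v | above v w && ~~ above u v && (v != u)) g (depth v) =
    \sum_(v | above v u) g (depth v).
  apply: eq_bigl => v; apply/idP/idP => [/andP[/andP[vw Nuv] vNu]|vu].
    by have := above_chain uw vw; rewrite eq_sym (negPf vNu) (negPf Nuv).
  rewrite (above_trans vu uw) /=; apply/andP; split.
    by apply/negP => /(above_asym vu).
  by apply: contraTneq vu => ->; rewrite above_irr.
rewrite sum_above (big_cat_nat (n := (depth u).+1) (p := depth w)) //=;
  last exact: depth_lt.
rewrite big_nat_recr //= (addrC (g _)) addrC => /addrI <-.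
by apply: eq_bigl => v; rewrite andbC.
Qed.

(** * Triangular factorisation of the shifted Laplacian *)

Section Factorisation.
Variables (F : fieldType) (x : F).
Hypothesis xP : forall k, x - k%:R != 0.

(* Pivot of [x - L] at [v], once everything below [v] has been eliminated. *)
Definition pivot v : F :=
  (x - (depth v)%:R) * (x - (gdeg v).+1%:R) / (x - (depth v).+1%:R).

Definition elim_mx : 'M[F]_n := \matrix_(u, v)
  if u == v then 1 else if above u v then (x - (depth v)%:R)^-1 else 0.

(** A permutation contributing a nonzero term sends each vertex to itself or to a vertex below it,
    so depth never drops. The total depth is preserved, hence nothing moves. *)
Lemma det_elim_mx : \det elim_mx = 1.
Proof.
rewrite /determinant (bigD1 (1%g : 'S_n)) //= [X in _ + X]big1 => [|s sN1].
  rewrite addr0 odd_perm1 expr0 mul1r big1 // => i _.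
  by rewrite mxE perm1 eqxx.
suff [i Ni] : exists i, elim_mx i (s i) = 0.
  by rewrite (bigD1 i) //= Ni mul0r mulr0.
have [/existsP[i /eqP]|/existsPn all_le] :=
  boolP [exists i, elim_mx i (s i) == 0]; first by exists i.
have le_s i : (i == s i) || above i (s i).
  move: (all_le i); rewrite mxE; case: (eqVneq i (s i)) => //= _.
  by case: (above i (s i)); rewrite ?eqxx.
case/negP: sN1; apply/eqP/permP => i; rewrite perm1.
have le i0 (_ : true) : (depth i0 <= depth (s i0) ?= iff (i0 == s i0))%N.
  split; first by case/orP: (le_s i0) => [/eqP<-//|/depth_lt/ltnW].
  case/orP: (le_s i0) => [/eqP<-|h]; first by rewrite !eqxx.
  have := depth_lt h; case: eqP => [->|_]; first by rewrite ltnn.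
  by move=> _; apply/esym/negbTE; apply: contraTneq h => <-; rewrite above_irr.
have [_] := leqif_sum le.
rewrite [X in _ == X](_ : _ = \sum_i depth i)%N; last first.
  by rewrite [RHS](reindex_inj (@perm_inj _ s)).
by rewrite eqxx => /esym/forallP/(_ i)/eqP.
Qed.

(* Partial fractions of [pivot w / (x - depth w) ^ 2] make the sum telescope
   along each chain from [u] down to [w]. *)
Lemma sum_below_pivot u :
  \sum_(v | above u v) pivot v / (x - (depth v)%:R) ^+ 2 =
  #|[pred w | above u w]|%:R / (x - (depth u).+1%:R).
Proof.
pose g k : F := (x - k%:R)^-1.
transitivity (\sum_(v | above u v)
   (g (depth v) + \sum_(w | above v w) (g (depth v) - g (depth v).+1))).
  apply: eq_bigr => v _; rewrite sumr_const -[_ *+ #|_|]mulr_natr /pivot /g.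
  have -> : (gdeg v).+1%:R = (depth v)%:R + #|above v|%:R + 1 :> F.
    by rewrite gdegE -natr1 natrD.
  have := xP (depth v).+1; rewrite -natr1.
  have := xP (depth v); set d := (depth v)%:R; set c := #|_|%:R => h0 h1.
  by field; rewrite h0 h1.
(* After the exchange each [w] below [u] collects [g (depth w)] and a telescoping sum over the
   vertices strictly between, in all [g (depth u).+1]. *)
rewrite big_split /= (exchange_big_dep (above u)) /=; last first.
  by move=> v w uv; exact: above_trans.
rewrite -big_split /= -[#|_|](sum1_card) natr_sum mulr_suml.
rewrite [LHS]big_mkcond [RHS]big_mkcond /=.
apply: eq_bigr => w _; rewrite inE; case: ifP => // uw.
rewrite sumrB (sum_between g uw) (sum_between (fun k => g k.+1) uw).
have := depth_lt uw; rewrite mul1r -/(g _).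
elim: (depth w) => // k IHk; rewrite ltnS leq_eqVlt => /predU1P[<-|lt_uk].
  by rewrite !big_geq ?subr0 ?addr0.
by rewrite !big_nat_recr //= -(IHk lt_uk); ring.
Qed.

(** With [S u] the sum over the vertices below [u]: if [u] is above [w], the term at [w] and [S w]
    add up to 1; on the diagonal [pivot u + S u] is [x - gdeg u]; incomparable vertices have no
    vertex below both. *)
Lemma elim_mx_factor :
  elim_mx *m diag_mx (\row_v pivot v) *m elim_mx^T =
  \matrix_(u, v) if u == v then x - (gdeg u)%:R else (e u v)%:R.
Proof.
pose S u : F := \sum_(v | above u v) pivot v / (x - (depth v)%:R) ^+ 2.
have SE u : S u = ((gdeg u)%:R - (depth u)%:R) / (x - (depth u).+1%:R).
  rewrite /S sum_below_pivot; congr (_ / _).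
  by rewrite [gdeg u in RHS]gdegE natrD [in RHS]addrC addKr.
have entry u w : (elim_mx *m diag_mx (\row_v pivot v) *m elim_mx^T) u w =
    \sum_v elim_mx u v * pivot v * elim_mx w v.
  by rewrite mxE; apply: eq_bigr => v _; rewrite mul_mx_diag !mxE.
have below u w : above u w ->
    \sum_v elim_mx u v * pivot v * elim_mx w v = 1.
  move=> uw; rewrite (bigD1 w) //= !mxE eqxx uw.
  have -> : (u == w) = false by apply: contraTF uw => /eqP->; rewrite above_irr.
  rewrite mulr1 (_ : \sum_(v | v != w) _ = S w).
    rewrite SE /pivot; have := xP (depth w); have := xP (depth w).+1.
    by rewrite -!natr1 => h1 h0; field; rewrite h0 h1.
  rewrite big_mkcond [S w]big_mkcond /=; apply: eq_bigr => v _.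
  rewrite !mxE (eq_sym w v); case: (eqVneq v w) => [->|vNw] /=.
    by rewrite above_irr.
  case wv: (above w v); last by rewrite mulr0.
  have uv := above_trans uw wv.
  have -> : (u == v) = false by apply: contraTF uv => /eqP->; rewrite above_irr.
  by rewrite uv expr2 invfM; ring.
apply/matrixP => u w; rewrite entry mxE; case: eqVneq => [<-|uNw].
  rewrite (bigD1 u) //= !mxE eqxx mul1r mulr1.
  rewrite (_ : \sum_(v | v != u) _ = S u).
    rewrite SE /pivot; have := xP (depth u); have := xP (depth u).+1.
    by rewrite -!natr1 => h1 h0; field; rewrite ?h0 h1.
  rewrite big_mkcond [S u]big_mkcond /=; apply: eq_bigr => v _.
  rewrite !mxE (eq_sym u v); case: (eqVneq v u) => [->|vNu] /=.
    by rewrite above_irr.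
  by case: ifP => uv; [rewrite expr2 invfM; ring | rewrite mulr0].
rewrite above_total; case uw: (above u w); first by rewrite below.
case wu: (above w u) => /=.
  by rewrite -(below _ _ wu); apply: eq_bigr => v _; ring.
rewrite big1 // => v _; rewrite !mxE.
case: (eqVneq u v) => [<-|uNv].
  by rewrite eq_sym (negPf uNw) wu mulr0.
case: (eqVneq w v) => [<-|wNv]; first by rewrite uw !mul0r.
case uv: (above u v); last by rewrite !mul0r.
case wv: (above w v); last by rewrite mulr0.
by have := above_chain uv wv; rewrite (negPf uNw) uw wu.
Qed.

Lemma det_shifted_laplacian :
  \det (\matrix_(u, v) if u == v then x - (gdeg u)%:R else (e u v)%:R) =
  \prod_v pivot v.
Proof.
rewrite -elim_mx_factor !det_mulmx det_tr det_elim_mx mulr1 mul1r det_diag.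
by apply: eq_bigr => v _; rewrite mxE.
Qed.

End Factorisation.

(** The factorisation is used over the fraction field of the polynomials with [x = 'X], where no
    [x - k] vanishes; clearing the denominators of the pivots gives a polynomial identity. *)
Lemma char_poly_quasi_threshold (A : 'M[algC]_n) :
  (forall u v, A u v = if u == v then (gdeg u)%:R else - (e u v)%:R) ->
  char_poly A * \prod_v ('X - ((depth v).+1%:R)%:P) =
  \prod_v ('X - ((gdeg v).+1%:R)%:P) * \prod_v ('X - ((depth v)%:R)%:P).
Proof.
move=> AE; pose toF : {rmorphism {poly algC} -> {fraction {poly algC}}} :=
  @FracField.tofrac {poly algC}.
pose x : {fraction {poly algC}} := toF 'X.
have xE k : x - k%:R = toF ('X - (k%:R)%:P).
  by rewrite rmorphB /= polyC_natr rmorph_nat.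
have xP k : x - k%:R != 0 by rewrite xE tofrac_eq0 polyXsubC_eq0.
apply/eqP; rewrite -(tofrac_eq (R := {poly algC})) -/(toF _); apply/eqP.
rewrite -[LHS]/(toF _) -[RHS]/(toF _) !rmorphM /= !rmorph_prod /=.
have -> : toF (char_poly A) = \prod_v pivot x v.
  rewrite -det_shifted_laplacian // /char_poly -det_map_mx; congr (\det _).
  apply/matrixP => u v; rewrite !mxE AE; case: (eqVneq u v) => [_|uNv].
    by rewrite mulr1n -xE.
  by rewrite mulr0n sub0r polyCN opprK polyC_natr rmorph_nat.
rewrite -!big_split; apply: eq_bigr => v _ /=.
by rewrite -!xE /pivot divfK // mulrC.
Qed.

End Spectrum.

(** * Structured RAM code *)

(* Code is a function of the address at which it is placed. *)
Definition code := nat -> seq instr.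

Definition block (l : seq instr) : code := fun _ => l.

Definition seqc (c1 c2 : code) : code := fun pc =>
  c1 pc ++ c2 (pc + size (c1 pc)).

Definition ifz (a : nat) (c1 c2 : code) : code := fun pc =>
  let s2 := c2 pc.+1 in
  let s1 := c1 (pc + size s2).+2 in
  IJz a (pc + size s2).+2 :: s2 ++ IJmp (pc + size s2 + size s1).+2 :: s1.

(* Runs [c0], leaves if cell [a] is 0, otherwise runs [c1] and starts again. *)
Definition loop (c0 : code) (a : nat) (c1 : code) : code := fun pc =>
  let s0 := c0 pc in
  let s1 := c1 (pc + size s0).+1 in
  s0 ++ IJz a (pc + size s0 + size s1).+2 :: s1 ++ [:: IJmp pc].

(** Quantifying over the surrounding program makes the statement independent of position, and the
    leftover fuel [t] makes step counts add. The exact count is hidden, so [k] is only an upper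
    bound. *)
Definition runs (k : nat) (c : code) (M M' : ram_mem) : Prop :=
  exists2 k', k' <= k & forall pre post t,
    run (pre ++ c (size pre) ++ post) (k' + t) (size pre, M) =
    run (pre ++ c (size pre) ++ post) t (size pre + size (c (size pre)), M').

Lemma runs_le k k' c M M' : k <= k' -> runs k c M M' -> runs k' c M M'.
Proof. by move=> le_k [j le_j H]; exists j => //; apply: leq_trans le_k. Qed.

Lemma runs_seqc k1 k2 c1 c2 M M1 M2 :
  runs k1 c1 M M1 -> runs k2 c2 M1 M2 -> runs (k1 + k2) (seqc c1 c2) M M2.
Proof.
move=> [j1 le1 H1] [j2 le2 H2]; exists (j1 + j2) => [|pre post t]; first exact: leq_add.
have := H1 pre (c2 (size pre + size (c1 (size pre))) ++ post) (j2 + t).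
have := H2 (pre ++ c1 (size pre)) post t.
by rewrite /seqc !size_cat -!catA -!addnA => -> ->.
Qed.

Lemma run_jz pre a l post M t pc : size pre = pc ->
  run (pre ++ IJz a l :: post) t.+1 (pc, M) =
  run (pre ++ IJz a l :: post) t (if M a == 0 then l else pc.+1, M).
Proof. by move=> <- /=; rewrite nth_cat ltnn subnn. Qed.

Lemma run_jmp pre l post M t pc : size pre = pc ->
  run (pre ++ IJmp l :: post) t.+1 (pc, M) = run (pre ++ IJmp l :: post) t (l, M).
Proof. by move=> <- /=; rewrite nth_cat ltnn subnn. Qed.

Lemma runs_ifz_true k a c1 c2 M M' :
  M a = 0 -> runs k c1 M M' -> runs k.+1 (ifz a c1 c2) M M'.
Proof.
move=> Ma [j le_j H]; exists j.+1 => // pre post t.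
move eT: (j.+1 + t) => T.
rewrite /ifz; set pc := size pre; set s2 := c2 pc.+1; set s1 := c1 (pc + size s2).+2.
have := H (pre ++ IJz a (pc + size s2).+2 :: s2 ++
           [:: IJmp (pc + size s2 + size s1).+2]) post t.
rewrite size_cat /= size_cat /= addn1 !addnS -/pc -/s1 -!catA /= -!catA /= => Hr.
rewrite -eT addSn run_jz // Ma eqxx Hr.
by congr (run _ _ (_, _)); rewrite size_cat /=; lia.
Qed.

Lemma runs_ifz_false k a c1 c2 M M' :
  M a != 0 -> runs k c2 M M' -> runs k.+2 (ifz a c1 c2) M M'.
Proof.
move=> Ma [j le_j H]; exists j.+2 => // pre post t.
move eT: (j.+2 + t) => T.
rewrite /ifz; set pc := size pre; set s2 := c2 pc.+1; set s1 := c1 (pc + size s2).+2.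
have Hr u := H (pre ++ [:: IJz a (pc + size s2).+2])
  (IJmp (pc + size s2 + size s1).+2 :: s1 ++ post) u.
move: Hr; rewrite size_cat /= addn1 -/pc -/s2 -!catA /= => Hr.
rewrite -eT !addSn run_jz // (negPf Ma) -[(j + t).+1]addnS Hr.
have := @run_jmp (pre ++ IJz a (pc + size s2).+2 :: s2)
  (pc + size s2 + size s1).+2 (s1 ++ post) M' t (pc.+1 + size s2).
rewrite -catA cat_cons => ->; last by rewrite size_cat /=; lia.
by congr (run _ _ (_, _)); rewrite size_cat /=; lia.
Qed.

Lemma runs_loop_exit k c0 a c1 M M1 :
  runs k c0 M M1 -> M1 a = 0 -> runs k.+1 (loop c0 a c1) M M1.
Proof.
move=> [j le_j H] Ma; exists j.+1 => // pre post t.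
move eT: (j.+1 + t) => T.
rewrite /loop; set pc := size pre; set s0 := c0 pc; set s1 := c1 (pc + size s0).+1.
have := H pre (IJz a (pc + size s0 + size s1).+2 :: s1 ++ IJmp pc :: post).
rewrite -/pc -/s0 -!catA /= -!catA /= => Hr; rewrite -eT addSnnS Hr.
rewrite catA run_jz ?size_cat // Ma eqxx -catA.
by congr (run _ _ (_, _)); rewrite ?size_cat /= ?size_cat /=; lia.
Qed.

Lemma runs_loop_step k0 k1 k c0 a c1 M M1 M2 M3 :
  runs k0 c0 M M1 -> M1 a != 0 -> runs k1 c1 M1 M2 ->
  runs k (loop c0 a c1) M2 M3 -> runs (k0 + k1 + k).+2 (loop c0 a c1) M M3.
Proof.
move=> [j0 le0 H0] Ma [j1 le1 H1] [j le_j H].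
exists (j0 + j1 + j).+2 => [|pre post t]; first by lia.
move eT: ((j0 + j1 + j).+2 + t) => T.
have := H pre post t; rewrite /loop.
set pc := size pre; set s0 := c0 pc; set s1 := c1 (pc + size s0).+1.
have := H1 (pre ++ s0 ++ [:: IJz a (pc + size s0 + size s1).+2]) (IJmp pc :: post).
have := H0 pre (IJz a (pc + size s0 + size s1).+2 :: s1 ++ IJmp pc :: post).
rewrite !size_cat /= -/pc -/s0 !addn1 !addnS -/s1 -!catA /= -!catA /=.
move=> E0 E1 E.
have -> : T = j0 + (j1 + (j + t).+1).+1 by rewrite -eT; lia.
rewrite E0 catA run_jz ?size_cat // (negPf Ma) -catA E1.
have := @run_jmp (pre ++ s0 ++ IJz a (pc + size s0 + size s1).+2 :: s1)
  pc post M2 (j + t) ((pc + size s0).+1 + size s1).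
rewrite -!catA cat_cons => ->; last by rewrite !size_cat /=; lia.
by rewrite E size_cat /= !addnS.
Qed.

Definition straight (i : instr) : bool :=
  match i with IJz _ _ | IJmp _ | IHalt => false | _ => true end.

Definition effect (M : ram_mem) (i : instr) : ram_mem :=
  match i with
  | ICnst a k => upd M a k
  | IAdd a b c => upd M a (M b + M c)
  | ISub a b c => upd M a (M b - M c)
  | ILoad a b => upd M a (M (M b))
  | IStore a b => upd M (M a) (M b)
  | _ => M
  end.

Lemma runs_block l M : all straight l ->
  runs (size l) (block l) M (foldl effect M l).
Proof.
move=> str; exists (size l) => // pre post t; rewrite /block.
elim: l pre M str => [|i l IHl] pre M /=; first by rewrite addn0.
case/andP=> str_i str_l; have := IHl (rcons pre i) (effect M i) str_l.
rewrite cat_rcons size_rcons nth_cat ltnn subnn /= addSnnS => <-.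
by case: i str_i.
Qed.

(** * Memories with sixteen registers *)

(** The registers form an explicit list, so that their contents reduce by computation; [h] is
    consulted from address 16 on only. *)
Definition mk (rs : seq nat) (h : nat -> nat) : ram_mem :=
  fun x => if x < 16 then nth 0 rs x else h x.

Lemma mk_reg rs h a : a < 16 -> mk rs h a = nth 0 rs a.
Proof. by rewrite /mk => ->. Qed.

Lemma mk_heap rs h a : 16 <= a -> mk rs h a = h a.
Proof. by rewrite /mk leqNgt => /negPf ->. Qed.

Lemma upd_reg rs h a v : a < 16 -> upd (mk rs h) a v = mk (set_nth 0 rs a v) h.
Proof.
move=> lt_a; apply: functional_extensionality => x; rewrite /upd /mk nth_set_nth /=.
by case: eqP => // ->; rewrite lt_a.
Qed.

Lemma upd_heap rs h a v : 16 <= a -> upd (mk rs h) a v = mk rs (upd h a v).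
Proof.
move=> le_a; apply: functional_extensionality => x; rewrite /upd /mk.
by case: eqP => // ->; rewrite [a < 16]ltnNge le_a.
Qed.

Section Effects.
Variables (rs : seq nat) (h : nat -> nat).

Lemma effect_cnst a k : a < 16 ->
  effect (mk rs h) (ICnst a k) = mk (set_nth 0 rs a k) h.
Proof. exact: upd_reg. Qed.

Lemma effect_add a b c : a < 16 -> b < 16 -> c < 16 ->
  effect (mk rs h) (IAdd a b c) = mk (set_nth 0 rs a (nth 0 rs b + nth 0 rs c)) h.
Proof. by move=> ? ? ?; rewrite /= !mk_reg // upd_reg. Qed.

Lemma effect_sub a b c : a < 16 -> b < 16 -> c < 16 ->
  effect (mk rs h) (ISub a b c) = mk (set_nth 0 rs a (nth 0 rs b - nth 0 rs c)) h.
Proof. by move=> ? ? ?; rewrite /= !mk_reg // upd_reg. Qed.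

Lemma effect_load a b : a < 16 -> b < 16 -> 16 <= nth 0 rs b ->
  effect (mk rs h) (ILoad a b) = mk (set_nth 0 rs a (h (nth 0 rs b))) h.
Proof. by move=> ? ? ?; rewrite /= (mk_reg _ _ (a := b)) // mk_heap // upd_reg. Qed.

Lemma effect_store a b : a < 16 -> b < 16 -> 16 <= nth 0 rs a ->
  effect (mk rs h) (IStore a b) = mk rs (upd h (nth 0 rs a) (nth 0 rs b)).
Proof. by move=> ? ? ?; rewrite /= !mk_reg // upd_heap. Qed.

End Effects.

Arguments effect : simpl never.
Arguments upd : simpl never.

(** * Hoare triples with a step bound *)

Definition hoare (k : nat) (c : code) (P Q : ram_mem -> Prop) : Prop :=
  forall M, P M -> exists2 M', runs k c M M' & Q M'.

Lemma hoare_le k k' c P Q : k <= k' -> hoare k c P Q -> hoare k' c P Q.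
Proof. by move=> le_k H M /H[M' /(runs_le le_k)]; exists M'. Qed.

Lemma hoare_pre k c P P' Q : (forall M, P' M -> P M) -> hoare k c P Q -> hoare k c P' Q.
Proof. by move=> PP' H M /PP'/H. Qed.

Lemma hoare_apply k c (P Q Q' : ram_mem -> Prop) M : hoare k c P Q -> P M ->
  (forall M', Q M' -> Q' M') -> exists2 M', runs k c M M' & Q' M'.
Proof. by move=> H /H[M' r QM'] QQ'; exists M' => //; exact: QQ'. Qed.

Lemma hoare_seqc k1 k2 c1 c2 P Q R :
  hoare k1 c1 P Q -> hoare k2 c2 Q R -> hoare (k1 + k2) (seqc c1 c2) P R.
Proof.
move=> H1 H2 M /H1[M1 r1 /H2[M2 r2 RM2]]; exists M2 => //; exact: runs_seqc r1 r2.
Qed.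

Lemma hoare_block l k P Q : all straight l -> size l <= k ->
  (forall M, P M -> Q (foldl effect M l)) -> hoare k (block l) P Q.
Proof.
move=> str le_k PQ M /PQ QM; exists (foldl effect M l) => //.
exact: runs_le (runs_block M str).
Qed.

Lemma hoare_ifz k a c1 c2 P Q :
  hoare k c1 (fun M => P M /\ M a = 0) Q ->
  hoare k c2 (fun M => P M /\ M a <> 0) Q -> hoare k.+2 (ifz a c1 c2) P Q.
Proof.
move=> H1 H2 M PM; case: (eqVneq (M a) 0) => Ma.
  have [//|M' r QM'] := H1 M; exists M' => //.
  exact: runs_le (runs_ifz_true _ Ma r).
have [|M' r QM'] := H2 M; first by split=> //; apply/eqP.
by exists M' => //; exact: runs_ifz_false Ma r.
Qed.

(** [I i] holds before the test of round [i] and [J i] after it. The cost may vary with the round,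
    which allows amortised bounds. *)
Lemma hoare_loop k0 c0 a c1 n (cost : nat -> nat) (I J : nat -> ram_mem -> Prop) Q :
  (forall i, i < n -> hoare k0 c0 (I i) (fun M => J i M /\ M a <> 0)) ->
  (forall i, i < n -> hoare (cost i) c1 (J i) (I i.+1)) ->
  hoare k0 c0 (I n) (fun M => Q M /\ M a = 0) ->
  hoare (\sum_(0 <= i < n) (cost i + k0.+2) + k0.+1) (loop c0 a c1) (I 0) Q.
Proof.
move=> Htest Hbody Hexit; suff H i : i <= n ->
    hoare (\sum_(i <= j < n) (cost j + k0.+2) + k0.+1) (loop c0 a c1) (I i) Q.
  exact: H.
(* Induction on the number [k] of rounds left. *)
move=> le_in; have [k ->] : exists k, i = n - k by exists (n - i); rewrite subKn.
elim: k => [|k IHk].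
  rewrite subn0 big_geq // => M /Hexit[M1 r [QM Ma]]; exists M1 => //.
  exact: runs_loop_exit r Ma.
have [le_nk|lt_kn] := leqP n k.
  by have -> : n - k.+1 = n - k by lia.
have lt : n - k.+1 < n by lia.
have eS : (n - k.+1).+1 = n - k by lia.
move=> M /(Htest _ lt)[M1 r1 [/(Hbody _ lt)[M2 r2]]].
rewrite eS => /IHk[M3 r3 QM3] /eqP Ma; exists M3 => //.
rewrite big_ltn // eS; apply: runs_le (runs_loop_step r1 Ma r2 r3).
by lia.
Qed.

(** * The heap: low memory, then arrays at multiples of [F] *)

Definition zeroes : nat -> nat := fun=> 0.

(* [nth zeroes fs i] is the array starting at address [i.+2 * F]. *)
Definition hp (F : nat) (lo : nat -> nat) (fs : seq (nat -> nat)) : nat -> nat :=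
  fun x => if x < 2 * F then lo x else nth zeroes fs (x %/ F - 2) (x %% F).

Arguments hp : simpl never.

Lemma hp_lo F lo fs x : x < 2 * F -> hp F lo fs x = lo x.
Proof. by rewrite /hp => ->. Qed.

Lemma hp_arr F lo fs i j : j < F -> hp F lo fs (i.+2 * F + j) = nth zeroes fs i j.
Proof.
move=> lt_j; rewrite /hp ifF; last by nia.
have F_gt0 : 0 < F by lia.
by rewrite divnMDl // modnMDl divn_small // modn_small // addn0 subn2.
Qed.

Lemma upd_hp_lo F lo fs x v : x < 2 * F ->
  upd (hp F lo fs) x v = hp F (upd lo x v) fs.
Proof.
move=> lt_x; apply: functional_extensionality => y; rewrite /upd /hp.
by case: eqP => [->|//]; rewrite lt_x.
Qed.

Lemma upd_hp_arr F lo fs i j v : j < F -> upd (hp F lo fs) (i.+2 * F + j) v =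
  hp F lo (set_nth zeroes fs i (upd (nth zeroes fs i) j v)).
Proof.
move=> lt_j; have F_gt0 : 0 < F by lia.
apply: functional_extensionality => y; rewrite /upd.
case: eqP => [->|neq]; first by rewrite hp_arr // nth_set_nth /= eqxx eqxx.
rewrite /hp; case: ifP => // /negbT; rewrite -leqNgt => le_y.
rewrite nth_set_nth /=; case: eqP => // ei; case: eqP => [ej|_]; last by rewrite ei.
case: neq; rewrite (divn_eq y F) ej; congr (_ * _ + _).
have : 2 <= y %/ F by rewrite leq_divRL.
by lia.
Qed.

Section HeapEffects.
Variables (F : nat) (rs : seq nat) (lo : nat -> nat) (fs : seq (nat -> nat)).
Hypothesis F_ge : 16 <= F.

Lemma effect_load_lo a b x : nth 0 rs b = x -> a < 16 -> b < 16 -> 16 <= x < 2 * F ->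
  effect (mk rs (hp F lo fs)) (ILoad a b) = mk (set_nth 0 rs a (lo x)) (hp F lo fs).
Proof. by move=> <- ? ? /andP[? ?]; rewrite effect_load // hp_lo. Qed.

Lemma effect_load_arr i j a b : nth 0 rs b = i.+2 * F + j -> a < 16 -> b < 16 ->
  j < F -> effect (mk rs (hp F lo fs)) (ILoad a b) =
  mk (set_nth 0 rs a (nth zeroes fs i j)) (hp F lo fs).
Proof. by move=> e ? ? ?; rewrite effect_load ?e ?hp_arr //; nia. Qed.

Lemma effect_store_lo a b x : nth 0 rs a = x -> a < 16 -> b < 16 -> 16 <= x < 2 * F ->
  effect (mk rs (hp F lo fs)) (IStore a b) = mk rs (hp F (upd lo x (nth 0 rs b)) fs).
Proof. by move=> <- ? ? /andP[? ?]; rewrite effect_store // upd_hp_lo. Qed.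

Lemma effect_store_arr i j a b : nth 0 rs a = i.+2 * F + j -> a < 16 -> b < 16 ->
  j < F -> effect (mk rs (hp F lo fs)) (IStore a b) =
  mk rs (hp F lo (set_nth zeroes fs i (upd (nth zeroes fs i) j (nth 0 rs b)))).
Proof. by move=> e ? ? ?; rewrite effect_store ?e ?upd_hp_arr //; nia. Qed.

End HeapEffects.

(** The default 0 of [nth] matches blank memory, so an array filled from the left is [nth 0] of a
    list growing at its end. *)
Lemma upd_nth s v : upd (nth 0 s) (size s) v = nth 0 (rcons s v).
Proof.
apply: functional_extensionality => x; rewrite /upd nth_rcons.
by case: ltngtP => // lt; rewrite nth_default // ltnW.
Qed.

Definition occ (s : seq nat) (x : nat) : nat := count_mem x s.

Lemma upd_occ s x : upd (occ s) x (occ s x).+1 = occ (rcons s x).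
Proof.
apply: functional_extensionality => y; rewrite /upd /occ -cats1 count_cat /= addn0.
by rewrite eq_sym; case: eqP => [->|]; rewrite ?addn1 ?addn0.
Qed.

Ltac ops := move=> /=; repeat (rewrite (effect_cnst, effect_add, effect_sub) //=).
Ltac eqregs := apply: (f_equal2 mk);
  [repeat (apply: (f_equal2 cons); [first [reflexivity | lia | idtac]|]); try reflexivity
  |try reflexivity].

(** * The program *)

(* On entry cell 0 holds [n] and cell 1 the degree [d] of vertex 0; cell 2 holds a
   neighbour of vertex 0, which is redundant and is the first scratch cell. *)
Definition triangle : code :=
  seqc (block [:: ICnst 2 1]) (loop (block [:: ISub 0 0 2; IAdd 1 1 0]) 0 (block [::])).

Definition triangular (n : nat) : nat := \sum_(0 <= i < n) i.

Lemma triangle_spec n d x t h :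
  hoare (4 * n + 6) triangle (eq (mk (n.+1 :: d :: x :: t) h))
    (eq (mk (0 :: d + triangular n.+1 :: 1 :: t) h)).
Proof.
have -> : 4 * n + 6 = 1 + (4 * n + 5) by lia.
apply: (@hoare_seqc _ _ _ _ _ (eq (mk (n.+1 :: d :: 1 :: t) h))).
  by apply: hoare_block => // _ <-; ops.
suff loopE : forall m d', runs (4 * m + 5)
    (loop (block [:: ISub 0 0 2; IAdd 1 1 0]) 0 (block [::]))
    (mk (m.+1 :: d' :: 1 :: t) h) (mk (0 :: d' + triangular m.+1 :: 1 :: t) h).
  by move=> _ <-; eexists; first exact: loopE.
have body m d' : runs 2 (block [:: ISub 0 0 2; IAdd 1 1 0])
    (mk (m.+1 :: d' :: 1 :: t) h) (mk (m :: d' + m :: 1 :: t) h).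
  have := runs_block (l := [:: ISub 0 0 2; IAdd 1 1 0]) (mk (m.+1 :: d' :: 1 :: t) h).
  by move=> /(_ isT) /=; ops; rewrite subn1.
elim=> [|m IHm] d'.
  rewrite /triangular big_nat1.
  by have := runs_loop_exit (a := 0) (block [::]) (body 0 d') erefl; exact: runs_le.
have -> : d' + triangular m.+2 = d' + m.+1 + triangular m.+1.
  by rewrite /triangular [in LHS]big_nat_recr //= addnAC addnA.
have := runs_loop_step (body m.+1 d') _ (runs_block (l := [::]) _ isT) (IHm _).
by move=> /(_ isT); apply: runs_le => /=; lia.
Qed.

(** With [s] in cell 1, six additions give [F = 64 * s] in cell 2. Cell 3 is saved first, to be
    reused for the constant 1 that moves the pointer; cells 3 to 15 end up at [F] to [F + 12]. *)
Definition save_regs : code := block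
  ([:: IAdd 2 1 1; IAdd 2 2 2; IAdd 2 2 2; IAdd 2 2 2; IAdd 2 2 2; IAdd 2 2 2;
       IStore 2 3; ICnst 3 1] ++
   flatten [seq [:: IAdd 2 2 3; IStore 2 b] | b <- iota 4 12]).

Definition blit (h : nat -> nat) (a : nat) (s : seq nat) : nat -> nat :=
  fun x => if a <= x < a + size s then nth 0 s (x - a) else h x.

Lemma upd_blit h a s v : upd (blit h a s) (a + size s) v = blit h a (rcons s v).
Proof.
apply: functional_extensionality => x; rewrite /upd /blit size_rcons addnS nth_rcons.
case: eqP => [->|neq].
  by rewrite leq_addr ltnSn addKn ltnn eqxx.
have [le|//] := leqP a x; rewrite /= ltnS.
have [lt|ge] := ltnP x (a + size s).
  by rewrite (ltnW lt) ifT //; lia.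
by rewrite ifF //; lia.
Qed.

Lemma effect_save rs h a s b : 16 <= a -> 0 < size s -> 3 < b < 16 ->
  nth 0 rs 2 = a + (size s).-1 -> nth 0 rs 3 = 1 ->
  effect (effect (mk rs (blit h a s)) (IAdd 2 2 3)) (IStore 2 b) =
  mk (set_nth 0 rs 2 (a + size s)) (blit h a (rcons s (nth 0 rs b))).
Proof.
move=> le_a s_gt0 /andP[lt_b ltb] r2 r3; ops; rewrite r2 r3 -addnA addn1 prednK //.
rewrite effect_store //; last by rewrite nth_set_nth /=; lia.
rewrite !nth_set_nth /= ifF; last by lia.
by rewrite upd_blit.
Qed.

Lemma save_regs_spec s x2 w3 w4 w5 w6 w7 w8 w9 w10 w11 w12 w13 w14 w15 h : 0 < s ->
  hoare 32 save_regs
  (eq (mk [:: 0; s; x2; w3; w4; w5; w6; w7; w8; w9; w10; w11; w12; w13; w14; w15] h))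
  (eq (mk [:: 0; s; 64 * s + 12; 1; w4; w5; w6; w7; w8; w9; w10; w11; w12; w13; w14; w15]
     (blit h (64 * s) [:: w3; w4; w5; w6; w7; w8; w9; w10; w11; w12; w13; w14; w15]))).
Proof.
move=> s_gt0; apply: hoare_block => // _ <- /=.
do 6 rewrite effect_add //=.
set F := (X in effect (mk (_ :: _ :: X :: _) _) _); have FE : F = 64 * s by rewrite /F; lia.
rewrite FE; move: (64 * s) (leq_mul (leqnn 64) s_gt0) => {F FE}G G_ge.
rewrite effect_store //=; last by lia.
have -> : upd h G w3 = blit h G [:: w3].
  rewrite -(upd_blit h G [::]) addn0; congr upd.
  by apply: functional_extensionality => x; rewrite /blit addn0; case: ifP => //; lia.
rewrite effect_cnst //=.
have G16 : 16 <= G by lia.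
by do 12 (rewrite effect_save ?addn0 //=).
Qed.

(* Inverts [triangle]: subtracting 0, 1, 2, ... from [d + triangular n] first becomes
   impossible at [n], because [d < n]. *)
Definition decode : code :=
  loop (block [:: IAdd 4 1 3; ISub 4 4 0]) 4 (block [:: ISub 1 1 0; IAdd 0 0 3]).

Lemma decode_spec n d p r4 t h : d < n ->
  hoare (6 * n + 3) decode (eq (mk (0 :: d + triangular n :: p :: 1 :: r4 :: t) h))
    (fun M => exists r4', M = mk (n :: d :: p :: 1 :: r4' :: t) h).
Proof.
move=> lt_dn.
pose I i M := exists r, M = mk (i :: d + \sum_(i <= j < n) j :: p :: 1 :: r :: t) h.
apply: (@hoare_pre _ _ (I 0)) => [_ <-|]; first by exists r4.
apply: (hoare_le _ (@hoare_loop 2 _ _ _ n (fun=> 2) I I _ _ _ _)) => [|i lt_i|i lt_i|].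
- by rewrite sum_nat_const_nat; lia.
- apply: hoare_block => // _ [r ->]; ops; split; first by eexists.
  by rewrite mk_reg //=; rewrite big_ltn //; lia.
- apply: hoare_block => // _ [r ->]; ops; rewrite (big_ltn lt_i).
  by eexists; eqregs.
(* The test is [d + 1 - n] here, which truncates to 0 because [d < n]. *)
- apply: hoare_block => // _ [r ->]; ops.
  split; last by rewrite mk_reg //= big_geq //; lia.
  by eexists; rewrite big_geq // addn0.
Qed.

(* Cell 1 of the input is restored as [d]; cell 2 is lost, but it is only read while
   scanning vertex 0, where every neighbour is skipped. Registers 11, 8, 13, 12 and 15
   receive the bases of the arrays of degrees, edges and depths and of the histograms of
   the [deg v + 1] and [d v + 1]; the output is collected from address [7 * F] on. *)
Definition setup : code := block
  [:: IAdd 9 2 3; ICnst 4 12; ISub 14 2 4; ICnst 4 2; ISub 2 14 4; IStore 2 1;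
      IAdd 11 14 14; IAdd 8 11 14; IAdd 13 8 14; IAdd 12 13 14; IAdd 15 12 14;
      ICnst 5 0].

Definition boot : code := seqc triangle (seqc save_regs (seqc decode setup)).

(* Where cell [a] of the input lives once the registers have been saved. *)
Definition vaddr (F a : nat) : nat := if a < 16 then F - 3 + a else a.

Lemma hp_zeroes F h : (forall x, 2 * F <= x -> h x = 0) ->
  h = hp F h (nseq 6 zeroes).
Proof.
move=> h0; apply: functional_extensionality => x; rewrite /hp nth_nseq if_same.
by case: ltnP => [//|/h0->].
Qed.

Lemma boot_spec w n d N F : w 0 = n -> w 1 = d -> 0 < d < n ->
    F = 64 * (d + triangular n) -> N.+2 <= F -> (forall x, N <= x -> w x = 0) ->
  hoare (10 * n + 49) boot (eq w) (fun M => exists r1 r4 r6 r7 r10 lo,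
    M = mk [:: n; r1; vaddr F 1; 1; r4; 0; r6; r7; 3 * F; F + 13; r10;
               2 * F; 5 * F; 4 * F; F; 6 * F] (hp F lo (nseq 6 zeroes)) /\
    (forall a, 0 < a < N -> a != 2 -> lo (vaddr F a) = w a)).
Proof.
move=> w0 w1 /andP[d_gt0 lt_dn] FE le_NF w_out.
have [m nE] : exists m, n = m.+1 by exists n.-1; lia.
have F_ge : 64 <= F by lia.
apply: (@hoare_le (4 * m + 6 + (32 + (6 * n + 3 + 12)))); first by lia.
apply: (@hoare_pre _ _ (eq (mk (m.+1 :: d :: w 2 ::
    [:: w 3; w 4; w 5; w 6; w 7; w 8; w 9; w 10; w 11; w 12; w 13; w 14; w 15]) w))).
  move=> _ <-; apply: functional_extensionality => x; rewrite /mk -nE -w0 -w1.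
  by case: ltnP => // lt_x; do 16 (case: x lt_x => [|x] lt_x //).
apply: (hoare_seqc (@triangle_spec m d _ _ _)); rewrite -nE.
have s_gt0 : 0 < d + triangular n by lia.
apply: (hoare_seqc (@save_regs_spec _ _ _ _ _ _ _ _ _ _ _ _ _ _ _ _ s_gt0)).
apply: (hoare_seqc (@decode_spec _ _ _ _ _ _ lt_dn)); rewrite -FE.
set sv := (X in blit _ _ X).
apply: hoare_block => // _ [r4 ->]; ops.
have -> : F + 12 - 12 - 2 = F - 2 by lia.
rewrite effect_store //=; last by lia.
ops; set lo := upd _ _ _; have lo_out x : 2 * F <= x -> lo x = 0.
  move=> le_x; rewrite /lo /upd ifF; last by lia.
  rewrite /blit ifF; last by rewrite /=; lia.
  by apply: w_out; lia.
(* The input and the saved cells end below [2 * F], so every array starts blank and no time is spent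
   on clearing. *)
rewrite {1}(hp_zeroes lo_out).
exists d, 2, (w 6), (w 7), (w 10), lo; split.
  by rewrite /vaddr /=; eqregs.
move=> a /andP[a_gt0 lt_a] a_neq2; rewrite /lo /upd /vaddr.
case: ltnP => [a_lt|a_ge].
  have [->|a_neq1] := eqVneq a 1; first by rewrite ifT //; lia.
  rewrite ifF; last by lia.
  rewrite /blit ifT /=; last by lia.
  have -> : F - 3 + a - F = a - 3 by lia.
  have {a_neq1 a_neq2 a_gt0} : 2 < a by lia.
  by do 16 (case: a a_lt lt_a => [|a] a_lt lt_a //).
rewrite ifF; last by lia.
by rewrite /blit ifF //; lia.
Qed.

(** * Reading the input: degrees, edges and the degree histogram *)

Lemma vaddr_bounds F a : 32 <= F -> a < F -> 16 <= vaddr F a < 2 * F.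
Proof. by rewrite /vaddr; case: (ltnP a 16); lia. Qed.

(** Register 9 holds [F + 13], the end of the saved cells. On reaching it the pointer jumps to 16,
    where the unmoved part of the input begins. *)
Definition advance : code := seqc (block [:: IAdd 2 2 3; ISub 4 9 2])
  (ifz 4 (block [:: ICnst 2 16]) (block [::])).

Lemma advance_spec F a r0 r1 r4 r5 r6 r7 r8 t h : 16 <= F -> a < F ->
  hoare 5 advance
  (eq (mk (r0 :: r1 :: vaddr F a :: 1 :: r4 :: r5 :: r6 :: r7 :: r8 :: F + 13 :: t) h))
  (fun M => exists r4, M =
    mk (r0 :: r1 :: vaddr F a.+1 :: 1 :: r4 :: r5 :: r6 :: r7 :: r8 :: F + 13 :: t) h).
Proof.
move=> F_ge lt_a.
apply: (@hoare_seqc 2 3 _ _ _ (eq (mk (r0 :: r1 :: vaddr F a + 1 :: 1 ::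
    F + 13 - (vaddr F a + 1) :: r5 :: r6 :: r7 :: r8 :: F + 13 :: t) h))).
  by apply: hoare_block => // _ <-; ops.
apply: hoare_ifz; apply: hoare_block => // _ [<-]; rewrite mk_reg //= => cmp; ops.
  eexists; eqregs; move: cmp; rewrite /vaddr.
  by case: (ltnP a 16); case: (ltnP a.+1 16); lia.
eexists; eqregs; move: cmp; rewrite /vaddr.
by case: (ltnP a 16); case: (ltnP a.+1 16); lia.
Qed.

Definition flat (E : seq (nat * nat)) : seq nat := flatten [seq [:: p.1; p.2] | p <- E].

Lemma flat_rcons E p : flat (rcons E p) = rcons (rcons (flat E) p.1) p.2.
Proof. by rewrite /flat map_rcons flatten_rcons -!cats1 -catA. Qed.

Lemma size_flat E : size (flat E) = 2 * size E.
Proof. by elim: E => //= p E; rewrite /flat /= => ->; lia. Qed.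

Lemma nth_flat E k : k < size E ->
  nth 0 (flat E) (2 * k) = (nth (0, 0) E k).1 /\
  nth 0 (flat E) (2 * k).+1 = (nth (0, 0) E k).2.
Proof.
by elim: E k => // p E IHE [|k] //; rewrite ltnS mulnS => /IHE.
Qed.

(** Every edge is recorded once, at its larger endpoint; in particular vertex 0 records nothing. *)
Definition back_edges (v : nat) (l : seq nat) : seq (nat * nat) :=
  [seq (v, u) | u <- l & u < v].

Definition scan_nbr : code :=
  seqc (block [:: ILoad 7 2; ISub 6 6 3]) (seqc advance
  (seqc (block [:: ISub 4 5 7])
    (ifz 4 (block [::]) (block [:: IStore 8 5; IAdd 8 8 3; IStore 8 7; IAdd 8 8 3])))).

Definition scan_list : code := loop (block [::]) 6 scan_nbr.

Lemma scan_list_spec F lo a v l E r0 r1 r4 r7 t f fs : 32 <= F -> a + size l <= F ->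
    2 * (size E + size l) < F ->
    (forall i, i < size l -> lo (vaddr F (a + i)) = nth 0 l i) ->
  hoare (16 * size l + 1) scan_list
  (eq (mk (r0 :: r1 :: vaddr F a :: 1 :: r4 :: v :: size l :: r7 ::
           3 * F + 2 * size E :: F + 13 :: t) (hp F lo (f :: nth 0 (flat E) :: fs))))
  (fun M => exists r4 r7, M =
     mk (r0 :: r1 :: vaddr F (a + size l) :: 1 :: r4 :: v :: 0 :: r7 ::
         3 * F + 2 * size (E ++ back_edges v l) :: F + 13 :: t)
       (hp F lo (f :: nth 0 (flat (E ++ back_edges v l)) :: fs))).
Proof.
move=> F_ge le_a le_E reads.
pose Ei i := E ++ back_edges v (take i l).
pose I i M := exists r4 r7, M =
     mk (r0 :: r1 :: vaddr F (a + i) :: 1 :: r4 :: v :: size l - i :: r7 ::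
         3 * F + 2 * size (Ei i) :: F + 13 :: t)
       (hp F lo (f :: nth 0 (flat (Ei i)) :: fs)).
apply: (@hoare_pre _ _ (I 0)) => [_ <-|].
  by exists r4, r7; rewrite /Ei take0 cats0 addn0 subn0.
apply: (hoare_le _ (@hoare_loop 0 _ _ _ (size l) (fun=> 14) I I _ _ _ _))
  => [|i lt_i|i lt_i|].
- by rewrite sum_nat_const_nat; lia.
- apply: hoare_block => // _ [r4' [r7' ->]] /=; split; first by exists r4', r7'.
  by rewrite mk_reg //=; lia.
- have EiS : Ei i.+1 = if nth 0 l i < v then rcons (Ei i) (v, nth 0 l i) else Ei i.
    rewrite /Ei (take_nth 0) // /back_edges filter_rcons.
    by case: ifP => // _; rewrite map_rcons -rcons_cat.
  have szE : size (Ei i) <= size E + i.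
    rewrite size_cat leq_add2l size_map size_filter.
    by apply: leq_trans (count_size _ _) _; rewrite size_take; case: ifP; lia.
  apply: (@hoare_seqc 2 12 _ _ _ (fun M => exists r4, M =
      mk (r0 :: r1 :: vaddr F (a + i) :: 1 :: r4 :: v :: size l - i.+1 :: nth 0 l i ::
          3 * F + 2 * size (Ei i) :: F + 13 :: t)
       (hp F lo (f :: nth 0 (flat (Ei i)) :: fs)))).
    apply: hoare_block => // _ [r4' [r7' ->]] /=.
    rewrite (@effect_load_lo _ _ _ _ _ _ (vaddr F (a + i))) //; last first.
      by apply: vaddr_bounds; lia.
    by ops; exists r4'; rewrite reads //; eqregs.
  apply: (@hoare_seqc 5 7 _ _ _ (fun M => exists r4, M =
      mk (r0 :: r1 :: vaddr F (a + i.+1) :: 1 :: r4 :: v :: size l - i.+1 :: nth 0 l i ::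
          3 * F + 2 * size (Ei i) :: F + 13 :: t)
       (hp F lo (f :: nth 0 (flat (Ei i)) :: fs)))).
    have [F16 lt_ai] : 16 <= F /\ a + i < F by lia.
    move=> _ [r4' ->]; rewrite (addnS a i).
    exact: (@advance_spec F (a + i) _ _ _ _ _ _ _ _ _ F16 lt_ai _ erefl).
  apply: (@hoare_seqc 1 6 _ _ _ (eq (
      mk (r0 :: r1 :: vaddr F (a + i.+1) :: 1 :: v - nth 0 l i :: v :: size l - i.+1 ::
          nth 0 l i :: 3 * F + 2 * size (Ei i) :: F + 13 :: t)
       (hp F lo (f :: nth 0 (flat (Ei i)) :: fs))))).
    by apply: hoare_block => // _ [r4' ->]; ops.
  apply: hoare_ifz; apply: hoare_block => // _ [<-]; rewrite mk_reg // => cmp.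
    by exists (v - nth 0 l i), (nth 0 l i); rewrite EiS ifF //; move: cmp => /=; lia.
  rewrite /= (@effect_store_arr _ _ _ _ _ 1 (2 * size (Ei i))) //; try lia.
  rewrite /= -size_flat upd_nth; ops.
  rewrite (@effect_store_arr _ _ _ _ _ 1 (2 * size (Ei i)).+1) //=; rewrite ?size_flat; try lia.
  rewrite -[X in upd _ X](_ : size (rcons (flat (Ei i)) v) = _); last first.
    by rewrite size_rcons size_flat.
  rewrite upd_nth; ops; rewrite /I EiS ifT; last by move: cmp => /=; lia.
  rewrite flat_rcons size_rcons; exists (v - nth 0 l i), (nth 0 l i); eqregs.
- apply: hoare_block => // _ [r4' [r7' ->]] /=; split; last by rewrite mk_reg //=; lia.
  by exists r4', r7'; rewrite subnn /Ei take_size.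
Qed.

Definition degrees (adj : seq (seq nat)) : seq nat := map size adj.

(** Address of the length cell of vertex [v] in [encode adj]; the successor accounts for the leading
    cell [n]. At [v = n] it is the length of the encoding. *)
Definition offset (adj : seq (seq nat)) (v : nat) : nat :=
  (v + sumn (take v (degrees adj))).+1.

Lemma nth_degrees adj v : nth 0 (degrees adj) v = size (nbrs adj v).
Proof.
rewrite /nbrs; have [lt|ge] := ltnP v (size adj); first by rewrite (nth_map [::]).
by rewrite !nth_default // size_map.
Qed.

Lemma take_degreesS adj v : v < size adj ->
  take v.+1 (degrees adj) = rcons (take v (degrees adj)) (size (nbrs adj v)).
Proof. by move=> lt; rewrite (take_nth 0) ?size_map // nth_degrees. Qed.

Lemma offsetS adj v : v < size adj ->
  offset adj v.+1 = (offset adj v).+1 + size (nbrs adj v).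
Proof. by move=> lt; rewrite /offset take_degreesS // sumn_rcons; lia. Qed.

Lemma sumn_take_le (s : seq nat) v : sumn (take v s) <= sumn s.
Proof. by rewrite -[in leqRHS](cat_take_drop v s) sumn_cat leq_addr. Qed.

Lemma offset_mono adj v w : v <= w -> offset adj v <= offset adj w.
Proof.
move=> le; rewrite /offset ltnS leq_add //.
by rewrite -(take_takel _ le) sumn_take_le.
Qed.

Lemma size_encode adj : size (encode adj) = offset adj (size adj).
Proof.
rewrite /encode /offset /= size_flatten /shape -map_comp; congr _.+1.
rewrite take_oversize ?size_map //; elim: adj => //= l adj IH.
by rewrite IH; lia.
Qed.

Lemma nth_encode adj v i : v < size adj -> i < (size (nbrs adj v)).+1 ->
  nth 0 (encode adj) (offset adj v + i) = nth 0 (size (nbrs adj v) :: nbrs adj v) i.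
Proof.
rewrite /offset /encode /degrees addSn /=; elim: adj v => [//|l adj IH] [|v] /=.
  by move=> _; rewrite add0n; case: i {IH} => //= i; rewrite ltnS nth_cat => ->.
rewrite ltnS => lt_v lt_i; rewrite -[nth 0 (_ :: _) i in RHS](IH v lt_v lt_i).
by rewrite addnCA -addnA nth_cat ltnNge leq_addr /= addKn.
Qed.

Definition edges_upto (adj : seq (seq nat)) (v : nat) : seq (nat * nat) :=
  flatten [seq back_edges i (nbrs adj i) | i <- iota 0 v].

Lemma edges_uptoS adj v :
  edges_upto adj v.+1 = edges_upto adj v ++ back_edges v (nbrs adj v).
Proof. by rewrite /edges_upto -[v.+1]addn1 iotaD map_cat flatten_cat /= cats0. Qed.

Lemma size_edges_upto adj v : v <= size adj ->
  size (edges_upto adj v) <= sumn (take v (degrees adj)).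
Proof.
elim: v => [|v IHv] le_v; first by rewrite take0.
rewrite edges_uptoS size_cat take_degreesS // sumn_rcons.
apply: leq_add; first exact/IHv/ltnW.
by rewrite size_map size_filter count_size.
Qed.

Definition scan_vertex : code :=
  seqc (block [:: ILoad 6 2]) (seqc advance
  (seqc (block [:: IStore 11 6; IAdd 11 11 3; IAdd 4 12 6; IAdd 4 4 3; ILoad 10 4;
                   IAdd 10 10 3; IStore 4 10])
  (seqc scan_list (block [:: IAdd 5 5 3])))).

Definition scan : code := loop (block [:: ISub 4 0 5]) 4 scan_vertex.

Lemma scan_spec F lo adj n r1 r4 r6 r7 r10 : n = size adj -> 32 <= F ->
    0 < size (nbrs adj 0) ->
    offset adj n <= F -> 2 * sumn (degrees adj) < F ->
    (forall v, v < n -> size (nbrs adj v) < n) -> n < F ->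
    (forall a, 0 < a < offset adj n -> a != 2 -> lo (vaddr F a) = nth 0 (encode adj) a) ->
  hoare (16 * sumn (degrees adj) + 18 * n + 2) scan
  (eq (mk [:: n; r1; vaddr F 1; 1; r4; 0; r6; r7; 3 * F; F + 13; r10;
               2 * F; 5 * F; 4 * F; F; 6 * F] (hp F lo (nseq 6 zeroes))))
  (fun M => exists r1 r2 r4 r5 r6 r7 r9 r10 r11, M =
     mk [:: n; r1; r2; 1; r4; r5; r6; r7; 3 * F + 2 * size (edges_upto adj n);
            r9; r10; r11; 5 * F; 4 * F; F; 6 * F]
       (hp F lo [:: nth 0 (degrees adj); nth 0 (flat (edges_upto adj n)); zeroes;
                    occ (map S (degrees adj)); zeroes; zeroes])).
Proof.
move=> nE F_ge deg0 off_le sum_lt deg_lt n_lt reads.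
(* The array index [v'], the reading position [s1] and the number [s2] of vertices whose edges are
   recorded are separate, as they advance at different moments of a round. *)
pose st r6 v r1 r4 r7 r10 v' s1 s2 : ram_mem :=
  mk [:: n; r1; vaddr F s1; 1; r4; v; r6; r7; 3 * F + 2 * size (edges_upto adj s2);
               F + 13; r10; 2 * F + v'; 5 * F; 4 * F; F; 6 * F]
       (hp F lo [:: nth 0 (take v' (degrees adj)); nth 0 (flat (edges_upto adj s2));
         zeroes; occ (map S (take v' (degrees adj))); zeroes; zeroes]).
pose I v M := exists r1 r4 r6 r7 r10, M = st r6 v r1 r4 r7 r10 v (offset adj v) v.
have degs_size : size (degrees adj) = n by rewrite size_map.
apply: (@hoare_pre _ _ (I 0)) => [_ <-|].
  exists r1, r4, r6, r7, r10; rewrite /st take0 /offset /= take0 muln0 !addn0; eqregs.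
  apply: f_equal; have nil0 : nth 0 [::] = zeroes.
    by apply: functional_extensionality => x; rewrite nth_nil.
  by rewrite /edges_upto /= nil0.
apply: (hoare_le _ (@hoare_loop 1 _ _ _ n (fun v => 16 * size (nbrs adj v) + 15)
    I I _ _ _ _)) => [|v lt_v|v lt_v|].
- rewrite leq_add // -[sumn _](_ : \sum_(0 <= v < n) size (nbrs adj v) = _); last first.
    rewrite sumnE [RHS](big_nth 0) degs_size.
    by apply: eq_bigr => v _; rewrite nth_degrees.
  by rewrite big_distrr /= !big_split /= !sum_nat_const_nat; lia.
- apply: hoare_block => // _ [r1' [r4' [r6' [r7' [r10' ->]]]]]; rewrite /st; ops.
  by split; [do 5 eexists; reflexivity | rewrite mk_reg //=; lia].
- have lt_va : v < size adj by rewrite -nE.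
  set d := size (nbrs adj v).
  have offS : offset adj v.+1 = (offset adj v).+1 + d by rewrite offsetS.
  have offn : (offset adj v).+1 + d <= offset adj n by rewrite -offS offset_mono.
  have lt_d : d < n by exact: deg_lt.
  (* Vertex 0 has a neighbour, so the lost cell 2 belongs to its list, and later vertices start at
     address 3 or beyond. *)
  have off_ge : 0 < v -> 3 <= offset adj v.
    by move=> v_gt0; have := offset_mono adj v_gt0; rewrite offsetS /offset; lia.
  have readd : lo (vaddr F (offset adj v)) = d.
    rewrite reads; [|by rewrite /offset in offn *; lia|].
      by rewrite -[offset _ _]addn0 nth_encode.
    by case: (posnP v) => [->|/off_ge]; [rewrite /offset take0 | lia].
  (* The list as memory yields it. For vertex 0 it may differ from the true list at the lost cell,
     but no entry is below 0, so the recorded edges agree. *)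
  pose l := mkseq (fun i => lo (vaddr F ((offset adj v).+1 + i))) d.
  have size_l : size l = d by rewrite size_mkseq.
  have lE : back_edges v l = back_edges v (nbrs adj v).
    case: (posnP v) => [->|/off_ge off3]; first by rewrite /back_edges !filter_pred0.
    congr back_edges; apply: (@eq_from_nth _ 0) => // i; rewrite size_l => lt_i.
    by rewrite nth_mkseq // reads; [rewrite addSnnS nth_encode | lia | lia].
  apply: (@hoare_le (1 + (5 + (7 + (16 * size l + 1 + 1))))); first by lia.
  apply: (@hoare_seqc _ _ _ _ _ (fun M => exists r1 r4 r7 r10, M =
      st d v r1 r4 r7 r10 v (offset adj v) v)).
    apply: hoare_block => // _ [r1' [r4' [r6' [r7' [r10' ->]]]]]; rewrite /st /=.
    rewrite (@effect_load_lo _ _ _ _ _ _ (vaddr F (offset adj v))) //; try lia; last first.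
      by apply: vaddr_bounds; lia.
    by rewrite /= readd; do 4 eexists.
  apply: (@hoare_seqc _ _ _ _ _ (fun M => exists r1 r4 r7 r10, M =
      st d v r1 r4 r7 r10 v (offset adj v).+1 v)).
    have [F16 lt_ai] : 16 <= F /\ offset adj v < F by lia.
    move=> _ [r1' [r4' [r7' [r10' ->]]]].
    rewrite /st; apply: (hoare_apply (@advance_spec F (offset adj v) _ _ _ _ _ _ _ _ _
      F16 lt_ai) erefl) => _ [r4'' ->].
    by exists r1', r4'', r7', r10'.
  apply: (@hoare_seqc _ _ _ _ _ (fun M => exists r1 r4 r7 r10, M =
      st (size l) v r1 r4 r7 r10 v.+1 (offset adj v).+1 v)).
    apply: hoare_block => // _ [r1' [r4' [r7' [r10' ->]]]]; rewrite /st /=.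
    have szt : size (take v (degrees adj)) = v by rewrite size_takel // degs_size ltnW.
    rewrite (@effect_store_arr _ _ _ _ _ 0 v) //=; try lia.
    ops; rewrite (@effect_load_arr _ _ _ _ _ 3 d.+1) //=; try lia.
    ops; rewrite (@effect_store_arr _ _ _ _ _ 3 d.+1) //=; try lia.
    rewrite [occ _ _ + 1]addn1 upd_occ -[X in upd (nth _ _) X]szt upd_nth.
    rewrite take_degreesS // map_rcons size_l.
    by do 4 eexists; eqregs.
  apply: (@hoare_seqc _ _ _ _ _ (fun M => exists r1 r4 r7 r10, M =
      st 0 v r1 r4 r7 r10 v.+1 (offset adj v.+1) v.+1)).
    move=> _ [r1' [r4' [r7' [r10' ->]]]].
    have szE := size_edges_upto (ltnW lt_va).
    have szT := sumn_take_le (degrees adj) v.+1.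
    rewrite take_degreesS // sumn_rcons -/d in szT.
    rewrite /st; apply: (hoare_apply (@scan_list_spec F lo _ _ l (edges_upto adj v)
      _ _ _ _ _ _ _ F_ge _ _ _) erefl); try lia.
      by move=> i; rewrite size_l => lt_i; rewrite nth_mkseq.
    move=> _ [r4'' [r7'' ->]]; exists r1', r4'', r7'', r10'.
    by rewrite /st edges_uptoS lE offS size_l.
  apply: hoare_block => // _ [r1' [r4' [r7' [r10' ->]]]]; rewrite /st; ops.
  by do 5 eexists; rewrite /st; eqregs.
- apply: hoare_block => // _ [r1' [r4' [r6' [r7' [r10' ->]]]]]; rewrite /st; ops.
  rewrite subnn; split; last by rewrite mk_reg.
  by do 9 eexists; rewrite take_oversize ?degs_size.
Qed.

(** * Depths from the edge list *)

Definition lower (deg : nat -> nat) (p : nat * nat) : nat :=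
  if deg p.1 <= deg p.2 then p.1 else p.2.

Definition deepen : code := seqc (block [:: IAdd 11 14 14; IAdd 7 11 14])
  (loop (block [:: ISub 4 8 7]) 4
    (seqc (block [:: ILoad 5 7; IAdd 7 7 3; ILoad 6 7; IAdd 7 7 3; IAdd 4 11 5;
                     ILoad 9 4; IAdd 4 11 6; ILoad 10 4; ISub 4 9 10])
    (seqc (ifz 4 (block [:: IAdd 4 13 5]) (block [:: IAdd 4 13 6]))
          (block [:: ILoad 9 4; IAdd 9 9 3; IStore 4 9])))).

Lemma deepen_spec F lo n E f0 f3 f4 f5 : 16 <= F -> 2 * size E < F ->
    all (fun p => (p.1 < F) && (p.2 < F)) E ->
  hoare (18 * size E + 4) deepen
  (fun M => exists r1 r2 r4 r5 r6 r7 r9 r10 r11, M =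
     mk [:: n; r1; r2; 1; r4; r5; r6; r7; 3 * F + 2 * size E;
            r9; r10; r11; 5 * F; 4 * F; F; 6 * F]
       (hp F lo [:: f0; nth 0 (flat E); zeroes; f3; f4; f5]))
  (fun M => exists r1 r2 r4 r5 r6 r7 r8 r9 r10, M =
     mk [:: n; r1; r2; 1; r4; r5; r6; r7; r8;
            r9; r10; 2 * F; 5 * F; 4 * F; F; 6 * F]
       (hp F lo [:: f0; nth 0 (flat E); occ (map (lower f0) E); f3; f4; f5])).
Proof.
move=> F_ge E_lt E_all.
pose I i M := exists r1 r2 r4 r5 r6 r9 r10, M =
     mk [:: n; r1; r2; 1; r4; r5; r6; 3 * F + 2 * i; 3 * F + 2 * size E;
            r9; r10; 2 * F; 5 * F; 4 * F; F; 6 * F]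
       (hp F lo [:: f0; nth 0 (flat E); occ (map (lower f0) (take i E)); f3; f4; f5]).
have -> : 18 * size E + 4 = 2 + (18 * size E + 2) by lia.
apply: (@hoare_seqc _ _ _ _ _ (I 0)).
  apply: hoare_block => // _ [r1 [r2 [r4 [r5 [r6 [r7 [r9 [r10 [r11 ->]]]]]]]]]; ops.
  by rewrite /I take0; do 7 eexists; eqregs.
apply: (hoare_le _ (@hoare_loop 1 _ _ _ (size E) (fun=> 15) I I _ _ _ _))
  => [|i lt_i|i lt_i|].
- by rewrite sum_nat_const_nat; lia.
- apply: hoare_block => // _ [r1 [r2 [r4 [r5 [r6 [r9 [r10 ->]]]]]]]; ops.
  by split; [do 7 eexists | rewrite mk_reg //=; lia].
- set p := nth (0, 0) E i.
  have /andP[p1_lt p2_lt] := all_nthP (0, 0) E_all _ lt_i.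
  have [e1 e2] := nth_flat lt_i.
  pose q := lower f0 p.
  pose st r1 r2 r4 r5 r6 r9 r10 :=
    mk [:: n; r1; r2; 1; r4; r5; r6; 3 * F + 2 * i.+1; 3 * F + 2 * size E;
            r9; r10; 2 * F; 5 * F; 4 * F; F; 6 * F]
       (hp F lo [:: f0; nth 0 (flat E); occ (map (lower f0) (take i E)); f3; f4; f5]).
  have q_lt : q < F by rewrite /q /lower; case: ifP.
  apply: (@hoare_seqc 9 6 _ _ _ (fun M => exists r1 r2 r9 r10, M =
     st r1 r2 (f0 p.1 - f0 p.2) p.1 p.2 r9 r10)).
    apply: hoare_block => // _ [r1 [r2 [r4 [r5 [r6 [r9 [r10 ->]]]]]]] /=.
    rewrite (@effect_load_arr _ _ _ _ _ 1 (2 * i)) //=; try lia.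
    ops; rewrite (@effect_load_arr _ _ _ _ _ 1 (2 * i).+1) //=; try lia.
    rewrite e1 e2 -/p.
    ops; rewrite (@effect_load_arr _ _ _ _ _ 0 p.1) //=; try lia.
    ops; rewrite (@effect_load_arr _ _ _ _ _ 0 p.2) //=; try lia.
    by ops; rewrite /st; do 4 eexists; eqregs.
  apply: (@hoare_seqc 3 3 _ _ _ (fun M => exists r1 r2 r9 r10, M =
     st r1 r2 (4 * F + q) p.1 p.2 r9 r10)).
    apply: hoare_ifz; apply: hoare_block => // _ [[r1 [r2 [r9 [r10 ->]]]]];
      rewrite /st mk_reg //= => cmp; ops; do 4 eexists; eqregs.
      by rewrite /q /lower ifT //; lia.
    by rewrite /q /lower ifF //; lia.
  apply: hoare_block => // _ [r1 [r2 [r9 [r10 ->]]]]; rewrite /st /=.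
  rewrite (@effect_load_arr _ _ _ _ _ 2 q) //=; try lia.
  ops; rewrite (@effect_store_arr _ _ _ _ _ 2 q) //=; try lia.
  rewrite [occ _ _ + 1]addn1 upd_occ -map_rcons -take_nth //.
  by rewrite /I; do 7 eexists; eqregs.
- apply: hoare_block => // _ [r1 [r2 [r4 [r5 [r6 [r9 [r10 ->]]]]]]]; ops.
  by rewrite subnn take_size mk_reg //=; split=> //; do 9 eexists.
Qed.

(** * Histogram of the shifted depths *)

Definition histogram : code := seqc (block [:: ICnst 4 0; IAdd 7 13 4; IAdd 8 13 0])
  (loop (block [:: ISub 4 8 7]) 4
     (block [:: ILoad 5 7; IAdd 7 7 3; IAdd 4 15 5; IAdd 4 4 3; ILoad 6 4;
                IAdd 6 6 3; IStore 4 6])).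

Lemma histogram_spec F lo n f0 f1 f2 f3 f5 : 16 <= F -> n < F ->
    (forall i, (f2 i).+1 < F) ->
  hoare (10 * n + 5) histogram
  (fun M => exists r1 r2 r4 r5 r6 r7 r8 r9 r10, M =
     mk [:: n; r1; r2; 1; r4; r5; r6; r7; r8; r9; r10; 2 * F; 5 * F; 4 * F; F; 6 * F]
       (hp F lo [:: f0; f1; f2; f3; zeroes; f5]))
  (fun M => exists r1 r2 r4 r5 r6 r7 r8 r9 r10, M =
     mk [:: n; r1; r2; 1; r4; r5; r6; r7; r8; r9; r10; 2 * F; 5 * F; 4 * F; F; 6 * F]
       (hp F lo [:: f0; f1; f2; f3; occ (mkseq (fun i => (f2 i).+1) n); f5])).
Proof.
move=> F_ge n_lt f2_lt.
pose I i M := exists r1 r2 r4 r5 r6 r9 r10, M =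
     mk [:: n; r1; r2; 1; r4; r5; r6; 4 * F + i; 4 * F + n; r9; r10;
            2 * F; 5 * F; 4 * F; F; 6 * F]
       (hp F lo [:: f0; f1; f2; f3; occ (mkseq (fun i => (f2 i).+1) i); f5]).
have -> : 10 * n + 5 = 3 + (10 * n + 2) by lia.
apply: (@hoare_seqc _ _ _ _ _ (I 0)).
  apply: hoare_block => // _ [r1 [r2 [r4 [r5 [r6 [r7 [r8 [r9 [r10 ->]]]]]]]]]; ops.
  by rewrite /I; do 7 eexists; eqregs.
apply: (hoare_le _ (@hoare_loop 1 _ _ _ n (fun=> 7) I I _ _ _ _))
  => [|i lt_i|i lt_i|].
- by rewrite sum_nat_const_nat; lia.
- apply: hoare_block => // _ [r1 [r2 [r4 [r5 [r6 [r9 [r10 ->]]]]]]]; ops.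
  by split; [do 7 eexists | rewrite mk_reg //=; lia].
- apply: hoare_block => // _ [r1 [r2 [r4 [r5 [r6 [r9 [r10 ->]]]]]]] /=.
  have lt2 := f2_lt i.
  rewrite (@effect_load_arr _ _ _ _ _ 2 i) //=; try lia.
  ops; rewrite (@effect_load_arr _ _ _ _ _ 4 (f2 i).+1) //=; try lia.
  ops; rewrite (@effect_store_arr _ _ _ _ _ 4 (f2 i).+1) //=; try lia.
  rewrite [occ _ _ + 1]addn1 upd_occ /I mkseqS.
  by do 7 eexists; eqregs.
- apply: hoare_block => // _ [r1 [r2 [r4 [r5 [r6 [r9 [r10 ->]]]]]]]; ops.
  by rewrite subnn mk_reg //=; split=> //; do 9 eexists.
Qed.

(** * Emitting the eigenvalues with multiplicity *)

Definition expand (mult : nat -> nat) (j : nat) : seq nat :=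
  flatten [seq nseq (mult i) i | i <- iota 0 j].

Lemma expandS mult j : expand mult j.+1 = expand mult j ++ nseq (mult j) j.
Proof. by rewrite /expand -[j.+1]addn1 iotaD map_cat flatten_cat /= cats0. Qed.

Lemma size_expand_mono mult i j : i <= j -> size (expand mult i) <= size (expand mult j).
Proof.
move=> /subnK <-; elim: (j - i) => [|k IHk] //.
by rewrite addSn expandS size_cat (leq_trans IHk) ?leq_addr.
Qed.

(** Writing starts at [7 * F + 1], so that [7 * F + a] holds the final content of cell [a] for
    [0 < a <= n]. Register 15 moves between the two reads of the depth histogram, at [j] and
    [j.+1]. *)
Definition emit : code :=
  seqc (block [:: ICnst 5 0; IAdd 7 15 14; IAdd 7 7 3; IAdd 8 0 3])
  (loop (block [:: ISub 4 8 5]) 4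
    (seqc (block [:: ILoad 6 12; IAdd 12 12 3; ILoad 10 15; IAdd 15 15 3; ILoad 9 15;
                     IAdd 6 6 9; ISub 6 6 10])
    (seqc (loop (block [::]) 6 (block [:: IStore 7 5; IAdd 7 7 3; ISub 6 6 3]))
          (block [:: IAdd 5 5 3])))).

Lemma emit_spec F lo n f0 f1 f2 f3 f4 (mult := fun j => f3 j + f4 j.+1 - f4 j) :
    16 <= F -> n.+2 < F -> (size (expand mult n.+1)).+1 < F ->
  hoare (12 * n.+1 + 5 * size (expand mult n.+1) + 6) emit
  (fun M => exists r1 r2 r4 r5 r6 r7 r8 r9 r10, M =
     mk [:: n; r1; r2; 1; r4; r5; r6; r7; r8; r9; r10; 2 * F; 5 * F; 4 * F; F; 6 * F]
       (hp F lo [:: f0; f1; f2; f3; f4; zeroes]))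
  (fun M => exists r1 r2 r4 r5 r6 r7 r9 r10 r12 r15, M =
     mk [:: n; r1; r2; 1; r4; r5; r6; r7; n.+1; r9; r10; 2 * F; r12; 4 * F; F; r15]
       (hp F lo [:: f0; f1; f2; f3; f4; nth 0 (0 :: expand mult n.+1)])).
Proof.
move=> F_ge n_lt out_lt.
pose st r1 r2 r4 j r6 r9 r10 j' s :=
     mk [:: n; r1; r2; 1; r4; j; r6; 7 * F + (size s).+1; n.+1; r9; r10;
            2 * F; 5 * F + j'; 4 * F; F; 6 * F + j']
       (hp F lo [:: f0; f1; f2; f3; f4; nth 0 (0 :: s)]).
pose I i M := exists r1 r2 r4 r6 r9 r10, M = st r1 r2 r4 i r6 r9 r10 i (expand mult i).
apply: (@hoare_le (4 + (12 * n.+1 + 5 * size (expand mult n.+1) + 2))); first by lia.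
apply: (@hoare_seqc _ _ _ _ _ (I 0)).
  apply: hoare_block => // _ [r1 [r2 [r4 [r5 [r6 [r7 [r8 [r9 [r10 ->]]]]]]]]]; ops.
  rewrite /I /st /expand /=; do 6 eexists; eqregs; apply: f_equal.
  have -> // : zeroes = nth 0 [:: 0].
  by apply: functional_extensionality => x; case: x => // x; rewrite /= nth_nil.
apply: (hoare_le _ (@hoare_loop 1 _ _ _ n.+1 (fun j => 9 + 5 * mult j) I I _ _ _ _))
  => [|i lt_i|i lt_i|].
(* Amortisation: over all [j] the inner loop runs once per emitted value. *)
- rewrite leq_add // [size _](_ : _ = \sum_(0 <= j < n.+1) mult j); last first.
    elim: n.+1 => [|k IHk]; first by rewrite big_geq.
    by rewrite expandS size_cat size_nseq IHk big_nat_recr.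
  by rewrite big_distrr /= !big_split /= !sum_nat_const_nat; lia.
- apply: hoare_block => // _ [r1 [r2 [r4 [r6 [r9 [r10 ->]]]]]]; rewrite /st; ops.
  by split; [do 6 eexists; reflexivity | rewrite mk_reg //=; lia].
- have szS : size (expand mult i) + mult i <= size (expand mult n.+1).
    by rewrite -[mult i](size_nseq _ i) -size_cat -expandS size_expand_mono.
  apply: (@hoare_le (7 + (5 * mult i + 1 + 1))); first by lia.
  apply: (@hoare_seqc _ _ _ _ _ (fun M => exists r1 r2 r4 r9 r10,
    M = st r1 r2 r4 i (mult i) r9 r10 i.+1 (expand mult i))).
    apply: hoare_block => // _ [r1 [r2 [r4 [r6 [r9 [r10 ->]]]]]]; rewrite /st /=.
    rewrite (@effect_load_arr _ _ _ _ _ 3 i) //=; try lia.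
    ops; rewrite (@effect_load_arr _ _ _ _ _ 4 i) //=; try lia.
    ops; rewrite (@effect_load_arr _ _ _ _ _ 4 i.+1) //=; try lia.
    by ops; do 5 eexists; eqregs.
  apply: (@hoare_seqc _ _ _ _ _ (fun M => exists r1 r2 r4 r9 r10,
    M = st r1 r2 r4 i 0 r9 r10 i.+1 (expand mult i.+1))).
    pose I' k M := exists r1 r2 r4 r9 r10,
      M = st r1 r2 r4 i (mult i - k) r9 r10 i.+1 (expand mult i ++ nseq k i).
    apply: (@hoare_pre _ _ (I' 0)) => [_ [r1 [r2 [r4 [r9 [r10 ->]]]]]|].
      by exists r1, r2, r4, r9, r10; rewrite subn0 cats0.
    apply: (hoare_le _ (@hoare_loop 0 _ _ _ (mult i) (fun=> 3) I' I' _ _ _ _))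
      => [|k lt_k|k lt_k|].
    + by rewrite sum_nat_const_nat; lia.
    + apply: hoare_block => // _ [r1 [r2 [r4 [r9 [r10 ->]]]]] /=.
      split; first by exists r1, r2, r4, r9, r10.
      by rewrite /st mk_reg //=; lia.
    + apply: hoare_block => // _ [r1 [r2 [r4 [r9 [r10 ->]]]]] /=.
      set s := expand mult i ++ nseq k i.
      have szs : size s = size (expand mult i) + k by rewrite size_cat size_nseq.
      rewrite (@effect_store_arr _ _ _ _ _ 5 (size s).+1) //=; try lia.
      rewrite (upd_nth (0 :: s)) /=; ops.
      have -> : expand mult i ++ nseq k.+1 i = rcons s i.
        by rewrite -cats1 -catA -[[:: i]]/(nseq 1 i) -nseqD addn1.
      by rewrite /I' /st size_rcons; do 5 eexists; eqregs.
    + apply: hoare_block => // _ [r1 [r2 [r4 [r9 [r10 ->]]]]] /=.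
      rewrite subnn; split; last by rewrite /st mk_reg.
      by exists r1, r2, r4, r9, r10; rewrite expandS.
  apply: hoare_block => // _ [r1 [r2 [r4 [r9 [r10 ->]]]]]; rewrite /st; ops.
  by rewrite /I /st; do 6 eexists; eqregs.
- apply: hoare_block => // _ [r1 [r2 [r4 [r6 [r9 [r10 ->]]]]]]; rewrite /st; ops.
  by rewrite subnn mk_reg //=; split=> //; do 10 eexists.
Qed.

(** * Moving the output to its final cells *)

Definition copy_out : code :=
  seqc (block [:: IAdd 7 13 11; IAdd 7 7 14; ICnst 5 16; IAdd 7 7 5])
  (loop (block [:: ISub 4 8 5]) 4
    (block [:: ILoad 6 7; IAdd 7 7 3; IStore 5 6; IAdd 5 5 3])).

(** Cells from 16 on can be overwritten while the registers still serve as such; the input there has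
    been consumed. *)
Lemma copy_out_spec F lo n f0 f1 f2 f3 f4 f5 : 16 <= F -> n < F ->
  hoare (7 * n + 6) copy_out
  (fun M => exists r1 r2 r4 r5 r6 r7 r9 r10 r12 r15, M =
     mk [:: n; r1; r2; 1; r4; r5; r6; r7; n.+1; r9; r10; 2 * F; r12; 4 * F; F; r15]
       (hp F lo [:: f0; f1; f2; f3; f4; f5]))
  (fun M => exists r1 r2 r4 r5 r6 r7 r9 r10 r12 r15 lo', M =
     mk [:: n; r1; r2; 1; r4; r5; r6; r7; n.+1; r9; r10; 2 * F; r12; 4 * F; F; r15]
       (hp F lo' [:: f0; f1; f2; f3; f4; f5]) /\
     (forall a, 16 <= a <= n -> lo' a = f5 a)).
Proof.
move=> F_ge n_lt.
pose I i M := exists r1 r2 r4 r6 r9 r10 r12 r15 lo', M =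
     mk [:: n; r1; r2; 1; r4; 16 + i; r6; 7 * F + (16 + i); n.+1; r9; r10;
            2 * F; r12; 4 * F; F; r15]
       (hp F lo' [:: f0; f1; f2; f3; f4; f5]) /\
     (forall a, 16 <= a < 16 + i -> lo' a = f5 a).
(* The difference truncates to 0 rounds when the output fits into the registers. *)
apply: (@hoare_le (4 + (7 * (n.+1 - 16) + 2))); first by lia.
apply: (@hoare_seqc _ _ _ _ _ (I 0)).
  apply: hoare_block => //.
  move=> _ [r1 [r2 [r4 [r5 [r6 [r7 [r9 [r10 [r12 [r15 ->]]]]]]]]]]; ops.
  by rewrite /I; do 9 eexists; split; [eqregs | lia].
apply: (hoare_le _ (@hoare_loop 1 _ _ _ (n.+1 - 16) (fun=> 4) I I _ _ _ _))
  => [|i lt_i|i lt_i|].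
- by rewrite sum_nat_const_nat; lia.
- apply: hoare_block => // _ [r1 [r2 [r4 [r6 [r9 [r10 [r12 [r15 [lo' [-> h]]]]]]]]]]; ops.
  by split; [do 9 eexists; split; [reflexivity | exact: h] | rewrite mk_reg //=; lia].
- apply: hoare_block => // _ [r1 [r2 [r4 [r6 [r9 [r10 [r12 [r15 [lo' [-> h]]]]]]]]]] /=.
  rewrite (@effect_load_arr _ _ _ _ _ 5 (16 + i)) //=; try lia.
  ops; rewrite (@effect_store_lo _ _ _ _ _ _ (16 + i)) //=; try lia.
  ops; rewrite /I; do 9 eexists; split; first by eqregs.
  by move=> a a_bnd; rewrite /upd; case: eqP => [->//|neq]; apply: h; lia.
- apply: hoare_block => // _ [r1 [r2 [r4 [r6 [r9 [r10 [r12 [r15 [lo' [-> h]]]]]]]]]]; ops.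
  split; last by rewrite mk_reg //=; lia.
  by do 11 eexists; split; [reflexivity | move=> a a_bnd; apply: h; lia].
Qed.

(* Cell 0 serves as the pointer while the registers are overwritten; as no other cell
   is left at the end, [n] has been stored at twice the final value of the pointer. *)
Definition finish : code := block
  ([:: IAdd 7 13 11; IAdd 7 7 14; IAdd 4 7 3; IAdd 4 4 4; IStore 4 0; ICnst 1 1;
       ICnst 4 15; IAdd 0 7 4] ++
   flatten [seq [:: ILoad b 0; ISub 0 0 1] | b <- rev (iota 2 14)] ++
   [:: ILoad 1 0; IAdd 0 0 0; ILoad 0 0]).

Lemma effect_restore F rs lo fs b : 16 <= F -> nth 0 rs 0 = 7 * F + b ->
  nth 0 rs 1 = 1 -> 1 < b < 16 ->
  effect (effect (mk rs (hp F lo fs)) (ILoad b 0)) (ISub 0 0 1) =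
  mk (set_nth 0 (set_nth 0 rs b (nth zeroes fs 5 b)) 0 (7 * F + b.-1)) (hp F lo fs).
Proof.
move=> F_ge r0 r1 /andP[b_gt b_lt].
rewrite (@effect_load_arr _ _ _ _ F_ge 5 b) //; last by lia.
rewrite effect_sub // !nth_set_nth /= !ifF ?r0 ?r1; try lia.
by have -> : 7 * F + b - 1 = 7 * F + b.-1 by lia.
Qed.

Lemma finish_spec F n f0 f1 f2 f3 f4 f5 : 16 <= F -> n < F ->
  hoare 39 finish
  (fun M => exists r1 r2 r4 r5 r6 r7 r9 r10 r12 r15 lo', M =
     mk [:: n; r1; r2; 1; r4; r5; r6; r7; n.+1; r9; r10; 2 * F; r12; 4 * F; F; r15]
       (hp F lo' [:: f0; f1; f2; f3; f4; f5]) /\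
     (forall a, 16 <= a <= n -> lo' a = f5 a))
  (fun M => M 0 = n /\ (forall a, 0 < a <= n -> M a = f5 a)).
Proof.
move=> F_ge n_lt; apply: hoare_block => //.
move=> _ [r1 [r2 [r4 [r5 [r6 [r7 [r9 [r10 [r12 [r15 [lo' [-> h]]]]]]]]]]]]; ops.
(* The address is [14 * F + 2], twice [7 * F + 1]: entry 2 of the array with index 12. Cell 1
   supplies the decrement, so it is restored after cells 15 to 2. *)
rewrite (@effect_store_arr _ _ _ _ _ 12 2) //=; try lia.
ops.
have -> : 4 * F + 2 * F + F + 15 = 7 * F + 15 by lia.
do 14 rewrite effect_restore //=.
rewrite (@effect_load_arr _ _ _ _ _ 5 1) //=; last by lia.
rewrite effect_add //= (@effect_load_arr _ _ _ _ _ 12 2) //=; try lia.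
split; first by rewrite mk_reg.
case=> // a /= a_le; have [a_lt|a_ge] := ltnP a.+1 16; last first.
  by rewrite mk_heap // hp_lo ?h //; lia.
by rewrite mk_reg //; do 15 (case: a a_le a_lt => [|a] //= a_le a_lt).
Qed.

(** * The whole program and its running time *)

Definition depths (adj : seq (seq nat)) : seq nat :=
  mkseq (occ (map (lower (nth 0 (degrees adj))) (edges_upto adj (size adj)))) (size adj).

(** The count of [j] in [{deg v + 1} + {d v} - {d v + 1}]; occurrences of [j] among the depths are
    those of [j.+1] among the shifted ones, so one depth histogram serves twice. *)
Definition multiplicity (adj : seq (seq nat)) (j : nat) : nat :=
  occ (map S (degrees adj)) j + occ (map S (depths adj)) j.+1 -
  occ (map S (depths adj)) j.

Definition eigenvalues (adj : seq (seq nat)) : seq nat :=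
  expand (multiplicity adj) (size adj).+1.

(** If cell 0 or cell 1 is 0, a connected graph has at most one vertex and its encoding, [0] or
    [1, 0], already is the output. *)
Definition spectrum_code : code :=
  ifz 0 (block [::]) (ifz 1 (block [::])
    (seqc boot (seqc scan (seqc deepen (seqc histogram
      (seqc emit (seqc copy_out finish))))))).

Lemma triangularE n : 2 * triangular n = n * n.-1.
Proof.
rewrite /triangular; elim: n => [|n IHn]; first by rewrite big_geq.
by rewrite big_nat_recr //= mulnDr IHn; case: n {IHn} => //= n; lia.
Qed.

Lemma size_nbrs_lt adj v : simple_graph adj -> v < size adj ->
  size (nbrs adj v) < size adj.
Proof.
move=> simple lt_v; have [/allP lt_n uniq_n irr _] := simple v lt_v.
have sub : {subset v :: nbrs adj v <= iota 0 (size adj)}.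
  by move=> x; rewrite inE mem_iota add0n => /predU1P[->//|/lt_n].
have := uniq_leq_size _ sub; rewrite size_iota; apply.
by rewrite /= uniq_n andbT.
Qed.

Lemma sumn_degrees_le adj : simple_graph adj ->
  sumn (degrees adj) <= size adj * (size adj).-1.
Proof.
move=> simple; rewrite sumnE big_map big_seq.
rewrite -[leqRHS](_ : \sum_(l <- adj) (size adj).-1 = _); last first.
  by rewrite big_const_seq count_predT iter_addn_0 mulnC.
rewrite [leqRHS]big_seq; apply: leq_sum => l l_adj.
have lt_l : index l adj < size adj by rewrite index_mem.
by have := size_nbrs_lt simple lt_l; rewrite /nbrs nth_index //; lia.
Qed.

(** The number of emitted values enters the cost, so the time bound relies on there being exactly
    [n] eigenvalues. *)
Lemma spectrum_code_spec adj : simple_graph adj -> 0 < size (nbrs adj 0) ->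
    size (eigenvalues adj) = size adj ->
  hoare (62 * size adj + 34 * sumn (degrees adj) + 150) spectrum_code
    (eq (init_mem (encode adj))) (fun M => output M = eigenvalues adj).
Proof.
move=> simple deg0 out_size; set n := size adj in out_size *.
have n_gt0 : 0 < n.
  by rewrite /n; case: adj deg0 {simple out_size n} => //; rewrite /nbrs nth_nil.
have d_lt : size (nbrs adj 0) < n by exact: size_nbrs_lt.
have w0 : init_mem (encode adj) 0 = n by [].
have w1 : init_mem (encode adj) 1 = size (nbrs adj 0).
  by have := nth_encode n_gt0 (ltn0Sn (size (nbrs adj 0))); rewrite /offset take0.
set d := size (nbrs adj 0) in d_lt w1 deg0.
(* [F] is [64 * d + 32 * n * (n - 1)], which exceeds the input length and twice the degree sum,
   itself at most [n * (n - 1)]. Addresses are quadratic in [n], but the time is not. *)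
pose F := 64 * (d + triangular n).
have triE := triangularE n; have sum_le := sumn_degrees_le simple; rewrite -/n in sum_le.
have n_le : n <= n * n.-1 by rewrite leq_pmulr //; lia.
have offE : offset adj n = (n + sumn (degrees adj)).+1.
  by rewrite /offset take_oversize // size_map.
have E_le : size (edges_upto adj n) <= sumn (degrees adj).
  by have := size_edges_upto (leqnn (size adj)); rewrite take_oversize // size_map.
apply: (@hoare_le ((10 * n + 49 + (16 * sumn (degrees adj) + 18 * n + 2 +
   (18 * size (edges_upto adj n) + 4 + (10 * n + 5 + (12 * n.+1 + 5 * n + 6 +
   (7 * n + 6 + 39)))))).+4)); first by lia.
apply: hoare_ifz; first by move=> _ [<-]; rewrite w0; lia.
apply: hoare_ifz; first by move=> _ [[<- _]]; rewrite w1; lia.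
apply: (@hoare_pre _ _ (eq (init_mem (encode adj)))) => [M [[]] //|].
apply: (hoare_seqc (@boot_spec _ n d (offset adj n) F w0 w1 _ _ _ _)) => //; try lia.
  by move=> x le_x; rewrite /init_mem nth_default // size_encode.
apply: (@hoare_seqc _ _ _ _ _ (fun M => exists lo r1 r2 r4 r5 r6 r7 r9 r10 r11, M =
     mk [:: n; r1; r2; 1; r4; r5; r6; r7; 3 * F + 2 * size (edges_upto adj n);
            r9; r10; r11; 5 * F; 4 * F; F; 6 * F]
       (hp F lo [:: nth 0 (degrees adj); nth 0 (flat (edges_upto adj n)); zeroes;
                    occ (map S (degrees adj)); zeroes; zeroes]))).
  move=> _ [r1 [r4 [r6 [r7 [r10 [lo [-> reads]]]]]]].
  apply: (hoare_apply (@scan_spec F lo adj n _ _ _ _ _ erefl _ deg0 _ _ _ _ reads) erefl);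
    try lia; first by move=> v; exact: size_nbrs_lt.
  by move=> M h; exists lo.
move=> M [lo hM]; move: M hM; rewrite -/(hoare _ _ _ _).
apply: (hoare_seqc (@deepen_spec _ _ _ _ _ _ _ _ _ _ _)); try lia.
  apply/allP => p /flattenP[_ /mapP[i + ->] /mapP[u + ->]].
  rewrite mem_iota add0n mem_filter /= => lt_i /andP[lt_u _].
  by rewrite (leq_trans lt_i) ?(leq_trans lt_u) //; lia.
set f2 := occ (map (lower _) _).
apply: (hoare_seqc (@histogram_spec _ _ _ _ _ _ _ _ _ _ _)); try lia.
  move=> i; suff : f2 i <= size (edges_upto adj n) by lia.
  by rewrite (leq_trans (count_size _ _)) // size_map.
have -> : mkseq (fun i => (f2 i).+1) n = map S (depths adj).
  by rewrite /depths /mkseq -map_comp.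
apply: (hoare_seqc _ (hoare_seqc (@copy_out_spec _ _ _ _ _ _ _ _ _ _ _) _)).
- have : 12 * n.+1 + 5 * size (eigenvalues adj) + 6 <= 12 * n.+1 + 5 * n + 6.
    by rewrite out_size.
  move/hoare_le; apply; apply: emit_spec; try lia.
  by rewrite -[X in (size X).+1]/(eigenvalues adj) out_size; lia.
- by lia.
- by lia.
move=> M hM; apply: (hoare_apply (@finish_spec F n _ _ _ _ _ _ _ _) hM); try lia.
move=> M' [M0 hM']; rewrite /output M0; apply: (@eq_from_nth _ 0).
  by rewrite size_mkseq.
move=> i; rewrite size_mkseq => lt_i; rewrite nth_mkseq // hM' //.
Qed.

(** * Counting list entries as sums over vertices *)

Lemma card_ord_mem n (s : seq nat) : uniq s -> all (fun x => x < n) s ->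
  #|[pred i : 'I_n | val i \in s]| = size s.
Proof.
move=> uniq_s /allP lt_s; rewrite cardE -(size_map val); apply: perm_size.
apply: uniq_perm => //; first by rewrite map_inj_uniq ?enum_uniq //; exact: val_inj.
move=> x; apply/mapP/idP => [[i]|x_s]; first by rewrite mem_enum inE => ? ->.
by exists (Ordinal (lt_s x x_s)); rewrite ?mem_enum ?inE.
Qed.

Lemma count_ord_mem n (P : pred nat) (s : seq nat) : uniq s -> all (fun x => x < n) s ->
  count P s = \sum_(i < n) ((val i \in s) && P i).
Proof.
move=> uniq_s all_s; rewrite -size_filter -(@card_ord_mem n).
- rewrite -sum1_card big_mkcond; apply: eq_bigr => i _.
  by rewrite !inE mem_filter andbC; case: ifP.
- by rewrite filter_uniq.
- by apply/allP => x; rewrite mem_filter => /andP[_]; exact: (allP all_s).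
Qed.

Lemma sum_eq_op (T : finType) (w : T) (f : T -> bool) : \sum_v ((v == w) && f v) = f w.
Proof.
by rewrite -[RHS](big_pred1_eq addn w f) big_mkcond; apply: eq_bigr => v _; case: eqP.
Qed.

(** * Correctness of the computed multiset *)

Section Graph.
Variable adj : seq (seq nat).
Hypotheses (simple : simple_graph adj) (qt : quasi_threshold adj).
Let n := size adj.
Let e : rel 'I_n := fun i j => adjb adj i j.

Lemma adj_sym : symmetric e.
Proof.
move=> i j; apply/idP/idP; rewrite /e => h.
  by have [_ _ _ ->] := simple (ltn_ord i).
by have [_ _ _ ->] := simple (ltn_ord j).
Qed.

Lemma adj_irr : irreflexive e.
Proof. by move=> i; have [_ _ /negPf] := simple (ltn_ord i). Qed.

Lemma adj_qt a b c d : uniq [:: a; b; c; d] ->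
  e a b -> e b c -> e c d -> ~~ e a c -> ~~ e b d -> False.
Proof.
rewrite -(map_inj_uniq val_inj) /= => uniq_abcd ab bc cd ac bd.
have [] := qt (ltn_ord a) (ltn_ord b) (ltn_ord c) (ltn_ord d) uniq_abcd.
rewrite /induced_P4 /induced_C4 -/(e a b) -/(e b c) -/(e c d) -/(e a c) -/(e b d).
rewrite -/(e a d) -/(e d a) ab bc cd (negPf ac) (negPf bd) (adj_sym d a) /=.
by rewrite !andbT => /negPn ->.
Qed.

Lemma gdeg_adj i : gdeg e i = size (nbrs adj i).
Proof.
by have [all_n uniq_n _ _] := simple (ltn_ord i); rewrite -(card_ord_mem uniq_n all_n).
Qed.

Lemma gdeg_nth i : nth 0 (degrees adj) (val i) = gdeg e i.
Proof. by rewrite nth_degrees gdeg_adj. Qed.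

(** A recorded pair [(v, u)] has [u < v] and adds to the depth of [i] when [i] is its lower end,
    either [v] or [u]; this gives the two sums. On equal degrees [lower] picks the larger label [v],
    in accordance with [above]. *)
Lemma depth_nth i : nth 0 (depths adj) (val i) = depth e i.
Proof.
rewrite /depths nth_mkseq; last exact: ltn_ord.
rewrite /occ /edges_upto count_map count_flatten -map_comp.
rewrite sumnE big_map -/(index_iota 0 _) -[X in iota 0 X]subn0 -/(index_iota 0 n) big_mkord.
transitivity (\sum_(v < n) \sum_(u < n)
    (((v == i) && [&& e v u, u < v & gdeg e v <= gdeg e u]) +
     ((u == i) && [&& e v u, u < v & gdeg e u < gdeg e v]))).
  apply: eq_bigr => v _; rewrite /= count_map count_filter.
  have [all_n uniq_n _ _] := simple (ltn_ord v).
  rewrite (count_ord_mem _ uniq_n all_n); apply: eq_bigr => u _.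
  rewrite /= /lower /= !gdeg_nth -/(adjb adj v u) -/(e v u) -!val_eqE /=.
  case: (leqP (gdeg e v) (gdeg e u)) => _; case: (e v u); case: (u < v);
  by case: (v == i :> nat); case: (u == i :> nat).
under eq_bigr do rewrite big_split /=; rewrite big_split /=.
rewrite exchange_big /=; under eq_bigr do rewrite sum_eq_op.
under [X in _ + X]eq_bigr do rewrite sum_eq_op.
rewrite -big_split /= /depth -sum1_card [RHS]big_mkcond; apply: eq_bigr => u _.
rewrite inE /above (adj_sym u i); case iu: (e i u) => //=.
have uNi : (u : nat) != i by apply: contraTneq iu => /val_inj ->; rewrite adj_irr.
by case: ltngtP uNi => //= _ _; case: ltngtP.
Qed.

End Graph.

(** * Reading the spectrum off the polynomial identity *)

Local Open Scope ring_scope.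

(** Each root of the left product occurs on the right, since distinct naturals stay distinct in
    [algC]; the linear factors cancel one at a time. *)
Lemma prod_XsubC_cancel (p : {poly algC}) (A B : seq nat) :
  p * \prod_(a <- A) ('X - (a%:R)%:P) = \prod_(b <- B) ('X - (b%:R)%:P) ->
  exists2 C, perm_eq B (A ++ C) & p = \prod_(c <- C) ('X - (c%:R)%:P).
Proof.
elim: A B => [|a A IHA] B; first by rewrite big_nil mulr1; exists B.
move=> pE; have aB : a \in B.
  have : root (\prod_(b <- B) ('X - (b%:R)%:P)) (a%:R : algC).
    by rewrite -pE big_cons mulrCA rootM root_XsubC eqxx.
  rewrite -(big_map (fun b => b%:R) xpredT (fun b => 'X - b%:P)) root_prod_XsubC.
  by case/mapP=> b bB /eqP; rewrite eqr_nat => /eqP->.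
have permB := perm_to_rem aB.
have [|C permC ->] := IHA (rem a B).
  have Xa0 : 'X - (a%:R : algC)%:P != 0 by rewrite polyXsubC_eq0.
  by move: pE; rewrite big_cons (perm_big _ permB) big_cons mulrCA => /(mulfI Xa0).
by exists C; rewrite // (perm_trans permB) //= perm_cons.
Qed.

Lemma occ_expand mult k j : occ (expand mult k) j = if (j < k)%N then mult j else 0%N.
Proof.
rewrite /occ; elim: k => [|k IHk] //; rewrite expandS count_cat IHk count_nseq /=.
by rewrite eq_sym ltnS; case: ltngtP => // [_|->]; rewrite ?mul1n ?addn0.
Qed.

Lemma prod_nth (s : seq nat) (n : nat) (f : nat -> {poly algC}) : size s = n ->
  \prod_(x <- s) f x = \prod_(i < n) f (nth 0%N s i).
Proof. by move=> <-; rewrite (big_nth 0%N) big_mkord. Qed.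

Lemma eigenvalues_spec adj : simple_graph adj -> quasi_threshold adj ->
  size (eigenvalues adj) = size adj /\
  char_poly (map_mx (fun z : int => z%:~R : algC) (laplacian adj)) =
  \prod_(x <- eigenvalues adj) ('X - (x%:R)%:P).
Proof.
move=> simple qt; set n := size adj; set L := map_mx _ _.
pose e : rel 'I_n := fun i j => adjb adj i j.
have size_degs : size (degrees adj) = n by rewrite size_map.
have size_depths : size (depths adj) = n by rewrite size_mkseq.
have LE u v : L u v = if u == v then (gdeg e u)%:R else - (e u v)%:R.
  rewrite !mxE; case: eqP => [_|_]; first by rewrite -pmulrn gdeg_adj.
  by rewrite rmorphN /= -pmulrn.
have := char_poly_quasi_threshold (adj_sym simple) (adj_irr simple)
  (adj_qt simple qt) LE.
have -> : \prod_v ('X - ((depth e v).+1%:R)%:P) =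
    \prod_(x <- map S (depths adj)) ('X - (x%:R)%:P) :> {poly algC}.
  by rewrite big_map (prod_nth _ size_depths); apply: eq_bigr => v _; rewrite depth_nth.
have -> : \prod_v ('X - ((gdeg e v).+1%:R)%:P) * \prod_v ('X - ((depth e v)%:R)%:P) =
    \prod_(x <- map S (degrees adj) ++ depths adj) ('X - (x%:R)%:P) :> {poly algC}.
  rewrite big_cat /= big_map (prod_nth _ size_degs) (prod_nth _ size_depths).
  by congr (_ * _); apply: eq_bigr => v _; rewrite ?depth_nth ?gdeg_nth.
case/prod_XsubC_cancel => C permC ->.
(* The shifted depths are a sub-multiset of the right-hand roots, so the subtraction in
   [multiplicity] never truncates. *)
have occC j : multiplicity adj j = occ C j.
  have := seq.permP permC (pred1 j); rewrite !count_cat -!/(occ _ _) /multiplicity.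
  have -> : occ (map S (depths adj)) j.+1 = occ (depths adj) j.
    by rewrite /occ count_map; apply: eq_count => x /=; rewrite eqSS.
  by lia.
(* No eigenvalue exceeds [n], so expanding up to [n] loses nothing. *)
have C_le x : x \in C -> (x < n.+1)%N.
  move=> xC; have : x \in map S (degrees adj) ++ depths adj.
    by rewrite (perm_mem permC) mem_cat xC orbT.
  rewrite mem_cat ltnS => /orP[/mapP[y /(nthP 0%N)[i]]|/(nthP 0%N)[i]].
    by rewrite size_degs => lt_i <- ->; rewrite nth_degrees size_nbrs_lt.
  rewrite size_depths => lt_i <-; rewrite (depth_nth simple (Ordinal lt_i)).
  by rewrite (leq_trans (max_card _)) // card_ord.
have permE : perm_eq C (eigenvalues adj).
  apply/allP => j _ /=; apply/eqP; rewrite -!/(occ _ _) /eigenvalues occ_expand occC.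
  case: ifP => // /negbT lt_j; apply/eqP; rewrite -leqn0 leqNgt -has_count.
  by apply/negP => /hasP[x xC /eqP xj]; case/negP: lt_j; rewrite -xj C_le.
split; last exact: perm_big.
rewrite -(perm_size permE); have := perm_size permC.
by rewrite !size_cat !(size_map S) size_depths size_degs; lia.
Qed.

(** Past the end of the program [nth] defaults to [IHalt]; noticing the halt takes one more unit of
    fuel, whence the strict inequality. *)
Lemma runs_halt k c M M' T : runs k c M M' -> (k < T)%N ->
  run (c 0%N) T (0%N, M) = Some M'.
Proof.
move=> [j le_j H] lt_T; have := H [::] [::] (T - j)%N.
rewrite subnKC ?cats0 /=; last by lia.
move=> ->; have [t ->] : exists t, (T - j = t.+1)%N by exists (T - j).-1; lia.
by rewrite /= add0n nth_default.
Qed.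

(** With two vertices, a path from 0 to 1 would start with a neighbour of 0. *)
Lemma isolated_vertex adj : simple_graph adj -> connected adj ->
  size (nbrs adj 0) = 0%N -> adj = [::] \/ adj = [:: [::]].
Proof.
move=> simple conn deg0; case: adj simple conn deg0 => [|l [|l' s]] simple conn deg0.
- by left.
- by right; case: l deg0 {simple conn}.
have [p [+ last_p]] := conn 0%N 1%N isT isT.
case: p last_p => // x p _ /andP[+ _].
by rewrite /adjb (size0nil deg0).
Qed.

Theorem theorem8 :
  exists (P : seq instr) (c : nat),
    forall adj : seq (seq nat),
      simple_graph adj -> connected adj -> quasi_threshold adj ->
      exists M : ram_mem,
        run P (c * (num_vertices adj + num_edges adj) + c)%N
            (0%N, init_mem (encode adj)) = Some M /\
        char_poly (map_mx (fun z : int => z%:~R : algC) (laplacian adj))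
          = \prod_(x <- output M) ('X - (x%:R)%:P).
Proof.
exists (spectrum_code 0%N), 200%N => adj simple conn qt.
have [out_size ->] := eigenvalues_spec simple qt.
set T := (_ + _)%N; suff [k lt_k [M r out]] : exists2 k, (k < T)%N &
    exists2 M, runs k spectrum_code (init_mem (encode adj)) M & output M = eigenvalues adj.
  by exists M; rewrite out (runs_halt r).
case: (posnP (size (nbrs adj 0))) => [deg0|deg0].
  exists 3%N; first by rewrite /T; lia.
  exists (init_mem (encode adj)).
    have [->|->] := isolated_vertex simple conn deg0.
      exact: runs_le (runs_ifz_true _ _ (runs_block (l := [::]) _ isT)).
    exact: (runs_ifz_false _ _ (runs_ifz_true _ _ (runs_block (l := [::]) _ isT))).
  by have [->|->] := isolated_vertex simple conn deg0.
exists (62 * size adj + 34 * sumn (degrees adj) + 150)%N.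
  rewrite /T /num_vertices /num_edges -/(degrees adj).
  (* The degree sum is at most [2 * num_edges adj + 1], and [34 + 150] stays below 200. *)
  by have := divn_eq (sumn (degrees adj)) 2; have := ltn_mod (sumn (degrees adj)) 2; lia.
exact: (spectrum_code_spec simple deg0 out_size erefl).
Qed.
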